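(* Let $\Gamma$ be a finitely generated group that is either elementary amenable or non-amenable. Then $\Gamma$ has polynomial growth if and only if $\Gamma$ has polynomial containment.
   Context: The class of elementary amenable groups is the smallest class of groups containing all finite groups and all abelian groups, and closed under taking subgroups, quotients, extensions, and direct unions (i.e. directed unions). The Cheeger constant of a locally finite graph $G$ is $h(G)=\inf_K |\partial K|/|K|$, where $K$ ranges over non-empty finite subsets of vertices of $G$ and $\partial K$ is the set of edges of $G$ with one endpoint in $K$ and the other endpoint not in $K$. The graph $G$ is amenable if $h(G)=0$ and non-amenable otherwise. A finitely generated group is amenable if its Cayley graph with respect to a finite generating set is amenable (this is independent of the finite generating set), and non-amenable otherwise. Let $G$ be a connected, locally finite graph, with combinatorial metric $\mathrm{dist}_G$ on its vertices ($\mathrm{dist}_G(x,y)$ is the length of a shortest edge-path from $x$ to $y$), and let $d$ be a non-negative integer. The graph $G$ has polynomial containment of degree at most $d$ if there is a constant $C>0$ such that for every finite set $X_0$ of vertices of $G$ there is a sequence $\{W_k : k\ge 1\}$ of subsets of vertices of $G$ such that: (1) for every $n\ge 1$, $|W_n|\le Cn^d$; (2) $X_n\cap W_{n+1}=\emptyset$ for every $n\ge 0$, where for $n\geq 1$ the set $X_n$ is defined recursively as the set of vertices at distance at most one from $X_{n-1}$ that do not belong to $W_1\cup\cdots\cup W_n$; (3) there is an integer $T>0$ such that $X_n=X_T$ for every $n\ge T$. A finitely generated group has polynomial containment of degree at most $d$ if its Cayley graph with respect to a finite generating set has polynomial containment of degree at most $d$ (this does not depend on the choice of finite generating set, since the property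 is preserved by quasi-isometry among connected graphs of bounded degree). A finitely generated group has polynomial containment if it has polynomial containment of degree at most $d$ for some non-negative integer $d$. For a connected, locally finite graph $G$ with a chosen vertex $g_0$, let $\beta(n)$ be the number of vertices at distance at most $n$ from $g_0$. The graph $G$ has polynomial growth of degree at most $d$ if there is a constant $C>0$ such that $\beta(n)\le Cn^d$ for every integer $n\ge 1$ (this is independent of $g_0$). A finitely generated group has polynomial growth if its Cayley graph with respect to a finite generating set has polynomial growth of degree at most $d$ for some non-negative integer $d$ (this is independent of the finite generating set). *)

(* Defs.v *)
From HB Require Import structures.
From mathcomp Require Import all_boot all_order all_algebra.
From mathcomp Require Import finmap.
From mathcomp Require Import all_classical reals.

Set Implicit Arguments.
Unset Strict Implicit.
Unset Printing Implicit Defensive.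

Import Order.TTheory GRing.Theory Num.Theory.

Local Open Scope classical_set_scope.
Local Open Scope ring_scope.

(** * Locally finite graphs *)

(** Simple graphs: loops and multiple edges affect neither distances nor
    whether the Cheeger constant of a Cayley graph vanishes. *)
Record graph := Graph {
  vertex :> choiceType;
  adj : rel vertex;
  adj_sym : symmetric adj;
  adj_irrefl : irreflexive adj;
  adj_locally_finite : forall x : vertex, finite_set [set y | adj x y] }.

Arguments adj {g}.

Record connected_graph := ConnectedGraph {
  cgraph :> graph;
  cgraph_connected : forall x y : cgraph,
    exists p : seq cgraph, path adj x p /\ last x p = y }.

Section Cheeger.
Variables (R : realType) (G : graph).

(** An edge between [K] and its complement has exactly one orientation
    leaving [K], so edges of the boundary are counted as pairs [(x, y)] with
    [x] in [K] and [y] outside [K]. *)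
Definition edge_boundary (K : {fset G}) : set (G * G) :=
  [set e | [/\ e.1 \in K, e.2 \notin K & adj e.1 e.2]].

Definition cheeger : R :=
  inf [set (#|` fset_set (edge_boundary K)|%:R / #|` K|%:R : R)
      | K in [set K : {fset G} | K != fset0]].

Definition amenable_graph : Prop := cheeger = 0.

End Cheeger.

Section Metric.
Variable G : connected_graph.

Definition walk_of_length (x y : G) (n : nat) : bool :=
  `[< exists p : seq G, [/\ path adj x p, last x p = y & size p = n] >].

Lemma walk_of_length_ex (x y : G) : exists n, walk_of_length x y n.
Proof.
have [p [xp pE]] := cgraph_connected x y.
by exists (size p); apply/asboolP; exists p.
Qed.

Definition graph_dist (x y : G) : nat := ex_minn (walk_of_length_ex x y).

Definition graph_ball (x : G) (n : nat) : set G :=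
  [set y | (graph_dist x y <= n)%N].

End Metric.

Definition polynomial_growth_degree (R : realType) (G : connected_graph)
    (g0 : G) (d : nat) : Prop :=
  exists2 C : R, 0 < C &
    forall n : nat, (1 <= n)%N ->
      #|` fset_set (graph_ball g0 n)|%:R <= C * n%:R ^+ d.

(** The sets [X_n]; the value [W 0] is never used. *)
Fixpoint burning (G : connected_graph) (X0 : {fset G}) (W : nat -> {fset G})
    (n : nat) : set G :=
  match n with
  | 0 => [set` X0]
  | m.+1 => [set v | (exists2 u, burning X0 W m u & (graph_dist v u <= 1)%N) /\
                     (forall k : nat, (1 <= k <= m.+1)%N -> v \notin W k)]
  end.

Definition polynomial_containment_degree (R : realType) (G : connected_graph)
    (d : nat) : Prop :=
  exists2 C : R, 0 < C &
    forall X0 : {fset G}, exists W : nat -> {fset G},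
      [/\ forall n : nat, (1 <= n)%N -> #|` W n|%:R <= C * n%:R ^+ d,
          forall n : nat, burning X0 W n `&` [set` W n.+1] = set0
        & exists2 T : nat, (0 < T)%N &
            forall n : nat, (T <= n)%N -> burning X0 W n = burning X0 W T].

(** * Cayley graphs *)

Section Cayley.
Variable gT : groupType.
Local Open Scope group_scope.

Definition generates (S : {fset gT}) : Prop :=
  forall H : {pred gT}, group_closed H -> {subset S <= H} ->
    forall x : gT, x \in H.

Variable S : {fset gT}.

Definition cayley_adj : rel gT :=
  fun x y => (x != y) && ((x^-1 * y \in S) || (y^-1 * x \in S)).

Lemma cayley_adj_sym : symmetric cayley_adj.
Proof. by move=> x y; rewrite /cayley_adj eq_sym orbC. Qed.

Lemma cayley_adj_irrefl : irreflexive cayley_adj.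
Proof. by move=> x; rewrite /cayley_adj eqxx. Qed.

Lemma cayley_adj_locally_finite (x : gT) :
  finite_set [set y | cayley_adj x y].
Proof.
apply: (@sub_finite_set _ _
  ([set x * s | s in [set` S]] `|` [set x * s^-1 | s in [set` S]])).
  move=> y /= /andP[_ /orP[xyS|yxS]]; [left | right].
    by exists (x^-1 * y) => //; rewrite mulVKg.
  by exists (y^-1 * x) => //; rewrite invgM invgK mulVKg.
by rewrite finite_setU; split; apply: finite_image; apply: finite_fset.
Qed.

Definition cayley_pregraph : graph :=
  Graph cayley_adj_sym cayley_adj_irrefl cayley_adj_locally_finite.

Hypothesis genS : generates S.

Lemma cayley_connected (x y : gT) :
  exists p : seq gT, path cayley_adj x p /\ last x p = y.
Proof.
pose H := [pred h : gT | `[< forall x : gT,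
  exists p : seq gT, path cayley_adj x p /\ last x p = x * h >]].
suff: x^-1 * y \in H.
  by move/asboolP => /(_ x); rewrite mulVKg.
have HM h k : h \in H -> k \in H -> h * k \in H.
  move=> /asboolP hH /asboolP kH; apply/asboolP => z.
  have [p [zp pE]] := hH z; have [q [zhq qE]] := kH (z * h).
  by exists (p ++ q); rewrite cat_path last_cat zp pE zhq qE mulgA.
have HV h : h \in H -> h^-1 \in H.
  move=> /asboolP hH; apply/asboolP => z.
  have [p [zp pE]] := hH (z * h^-1).
  exists (rev (belast (z * h^-1) p)); split.
    have := rev_path cayley_adj (z * h^-1) p.
    rewrite pE mulgVK => ->.
    by rewrite (eq_path (e' := cayley_adj)) // => a b; rewrite cayley_adj_sym.
  case: p zp pE => [|a p] /= _ pE; first by rewrite pE mulgVK.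
  by rewrite rev_cons last_rcons.
apply: genS.
  split; first by apply/asboolP => z; exists [::]; rewrite mulg1.
  by move=> h k hH kH; apply: HM => //; apply: HV.
move=> s sS; apply/asboolP => z.
have [->|s1] := eqVneq s 1; first by exists [::]; rewrite mulg1.
exists [:: z * s] => /=; split=> //.
rewrite andbT /cayley_adj mulKg sS andbT.
by apply: contraNneq s1 => zE; rewrite -(mulKg z s) -zE mulVg.
Qed.

Definition cayley_graph : connected_graph :=
  @ConnectedGraph cayley_pregraph cayley_connected.

End Cayley.

(** * Finitely generated groups *)

Definition finitely_generated (gT : groupType) : Prop :=
  exists S : {fset gT}, generates S.

(** The three properties below do not depend on the finite generating set. *)
Definition amenable (R : realType) (gT : groupType) : Prop :=
  exists (S : {fset gT}) (genS : generates S),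
    amenable_graph R (cayley_graph genS).

Definition polynomial_growth (R : realType) (gT : groupType) : Prop :=
  exists (S : {fset gT}) (genS : generates S) (d : nat),
    @polynomial_growth_degree R (cayley_graph genS) (1%g : gT) d.

Definition polynomial_containment (R : realType) (gT : groupType) : Prop :=
  exists (S : {fset gT}) (genS : generates S) (d : nat),
    polynomial_containment_degree R (cayley_graph genS) d.

(** * Elementary amenable groups *)

(** Subgroups are given by injective morphisms and quotients by surjective
    ones, which also makes the class closed under isomorphism. *)
Inductive elementary_amenable : groupType -> Prop :=
| EA_finite (G : groupType) :
    finite_set [set: G] -> elementary_amenable G
| EA_abelian (G : groupType) :
    (forall x y : G, commute x y) -> elementary_amenable G
| EA_subgroup (G H : groupType) (i : {multiplicative H -> G}) :
    injective i -> elementary_amenable G -> elementary_amenable H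
| EA_quotient (G Q : groupType) (p : {multiplicative G -> Q}) :
    range p = [set: Q] -> elementary_amenable G -> elementary_amenable Q
| EA_extension (N G Q : groupType)
    (i : {multiplicative N -> G}) (p : {multiplicative G -> Q}) :
    injective i -> range p = [set: Q] -> range i = [set g | p g = 1%g] ->
    elementary_amenable N -> elementary_amenable Q -> elementary_amenable G
| EA_directed_union (G : groupType) (I : Type) (H : I -> groupType)
    (f : forall i : I, {multiplicative H i -> G}) :
    (forall i : I, injective (f i)) ->
    (forall i j : I, exists k : I,
       range (f i) `<=` range (f k) /\ range (f j) `<=` range (f k)) ->
    \bigcup_i range (f i) = [set: G] ->
    (forall i : I, elementary_amenable (H i)) -> elementary_amenable G.

(* Main.v *)
Require Import Defs.
From HB Require Import structures.
From mathcomp Require Import all_boot all_order all_algebra.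
From mathcomp Require Import finmap.
From mathcomp Require Import all_classical reals.
From mathcomp Require Import zify ring lra.
From mathcomp Require Import algC.

Set Implicit Arguments.
Unset Strict Implicit.
Unset Printing Implicit Defensive.

Import Order.TTheory GRing.Theory Num.Theory.

(** Growth implies containment because a fire that starts in the ball of
    radius [r] can be left alone until time [r]: it is then confined to the
    ball of radius [2 r - 1], and the sphere of radius [2 r], which has at most
    [C * 2 ^ d * r ^ d] vertices, can be protected at once
    ([polynomial_growth_containment]).

    For the converse, a fire escapes as soon as the finite sets [K] of some
    hereditary family expand by a factor [1 + e] under right multiplication by
    a fixed finite set: the spread takes boundedly many time steps, so the sets
    of burning vertices satisfy [a (n+1) >= (1 + e) (a n - b n)] with [b] a
    polynomial, and a large enough initial fire outgrows the losses
    ([fire_escapes]).  In a non-amenable group all finite sets expand; if two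
    elements generate a free semigroup, the sets of words of a given length
    double.  So a group with polynomial containment is amenable and has no free
    subsemigroup of rank two.  What remains is that a finitely generated
    elementary amenable group without such a subsemigroup has polynomial
    growth (the circle of ideas of Milnor, Wolf, Rosenblatt and Chou).

    - Milnor's argument: an equality between two words of the same length in
      [t^-1 * b] and [t^-1] expresses [b] through its conjugates by positive
      powers of [t].  Hence in a finitely generated group without free
      subsemigroups, kernels of maps onto abelian groups are finitely generated
      ([fin_gen_abelian_kernel]).  With it, the construction of an elementary
      amenable group can be followed step by step to produce a finite subnormal
      series whose factors are finite or abelian
      ([elementary_amenable_tower]).

    - From the bottom of the series up, each term has a solvable normal
      subgroup of finite index; the solvable radical of a term is invariant
      under conjugation by the next one, and the centralizer of a finite
      section has finite index ([tower_virtually_solvable]).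

    - Let [K] be the solvable group of finite index obtained in this way and
      [phi] the conjugation by [g] in [K] on a factor [A] of its derived series.
      The absence of free subsemigroups gives, for every [m] and [a], a nonzero
      polynomial [f] with coefficients among -1, 0 and 1 such that [f(phi^m)] kills
      [a].  Thus a minimal integral annihilator [D] of [phi] is monic, and its
      roots satisfy [|x| ^ m <= 2] for all [m], that is [|x| <= 1]; so the
      remainder of ['X^n] modulo [D] has polynomially bounded coefficients and
      [phi^n] lengthens elements of [A] only polynomially ([orbit_short]).
      Going up the derived series, this lifts from the factors to the terms,
      and each term is at most polynomially distorted in the next one and
      inherits polynomial growth ([derived_series_poly_growth]). *)

(** * Integral polynomials in an additive endomorphism *)

Section AnnihilatorAction.
Local Open Scope ring_scope.
Variables (A : zmodType) (phi : A -> A).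
Hypothesis phiD : forall a b, phi (a + b) = phi a + phi b.

(** The module structure over the integral polynomials on [A] in which ['X]
    acts as [phi]. *)
Definition poly_act (f : {poly int}) (a : A) : A :=
  \sum_(i < size f) iter i phi a *~ f`_i.

Lemma additive_map0 : phi 0 = 0.
Proof. by apply: (addrI (phi 0)); rewrite -phiD !addr0. Qed.

Lemma additive_mapN a : phi (- a) = - phi a.
Proof. by apply: (addrI (phi a)); rewrite -phiD !subrr additive_map0. Qed.

Lemma additive_mapMz a z : phi (a *~ z) = phi a *~ z.
Proof.
have phiMn b n : phi (b *+ n) = phi b *+ n.
  by elim: n => [|n IHn]; rewrite ?mulr0n ?additive_map0 // !mulrS phiD IHn.
by case: z => n; rewrite ?NegzE ?mulrNz ?additive_mapN -?pmulrn phiMn.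
Qed.

Lemma iter_additive_mapD n a b : iter n phi (a + b) = iter n phi a + iter n phi b.
Proof. by elim: n => //= n ->. Qed.

Lemma additive_map_sum (I : Type) (r : seq I) (F : I -> A) :
  phi (\sum_(i <- r) F i) = \sum_(i <- r) phi (F i).
Proof. by elim/big_rec2: _ => [|i x y _ <-]; rewrite ?additive_map0. Qed.

Lemma poly_act_wide n (f : {poly int}) a : (size f <= n)%N ->
  poly_act f a = \sum_(i < n) iter i phi a *~ f`_i.
Proof.
move=> fn; rewrite /poly_act.
rewrite (big_ord_widen _ (fun i => iter i phi a *~ f`_i) fn) big_mkcond.
by apply: eq_bigr => i _; case: ltnP => // fi; rewrite nth_default.
Qed.

Lemma poly_actDr f a b : poly_act f (a + b) = poly_act f a + poly_act f b.
Proof.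
by rewrite /poly_act -big_split; apply: eq_bigr => i _; rewrite iter_additive_mapD mulrzDl.
Qed.

Lemma poly_actr0 f : poly_act f 0 = 0.
Proof. by apply: (addrI (poly_act f 0)); rewrite -poly_actDr !addr0. Qed.

Lemma poly_actDl f h a : poly_act (f + h) a = poly_act f a + poly_act h a.
Proof.
rewrite !(@poly_act_wide (maxn (size f) (size h))) ?size_polyD ?leq_maxl ?leq_maxr //.
by rewrite -big_split; apply: eq_bigr => i _; rewrite coefD mulrzDr.
Qed.

Lemma poly_act0l a : poly_act 0 a = 0.
Proof. by rewrite /poly_act size_poly0 big_ord0. Qed.

Lemma poly_actNl f a : poly_act (- f) a = - poly_act f a.
Proof. by apply: (addrI (poly_act f a)); rewrite -poly_actDl !subrr poly_act0l. Qed.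

Lemma poly_actBl f h a : poly_act (f - h) a = poly_act f a - poly_act h a.
Proof. by rewrite poly_actDl poly_actNl. Qed.

Lemma poly_actC c a : poly_act c%:P a = a *~ c.
Proof.
by rewrite (@poly_act_wide 1) ?size_polyC ?leq_b1 // big_ord1 /= coefC eqxx.
Qed.

Lemma poly_actMX f a : poly_act (f * 'X) a = phi (poly_act f a).
Proof.
rewrite (@poly_act_wide (size f).+1) ?(leq_trans (size_polyMleq _ _)) ?size_polyX ?addn2 //.
rewrite big_ord_recl coefMX /= mulr0z add0r /poly_act additive_map_sum.
by apply: eq_bigr => i _; rewrite coefMX /= additive_mapMz.
Qed.

Lemma poly_actMC c f a : poly_act (f * c%:P) a = poly_act f a *~ c.
Proof.
rewrite (@poly_act_wide (size f)) ?(leq_trans (size_polyMleq _ _)) //; last first.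
  by rewrite size_polyC; case: eqP; rewrite ?addn0 ?addn1 ?leq_pred.
by rewrite /poly_act mulrz_suml; apply: eq_bigr => i _; rewrite coefMC mulrzA.
Qed.

Lemma poly_actM f h a : poly_act (f * h) a = poly_act f (poly_act h a).
Proof.
elim/poly_ind: f => [|f c IHf]; first by rewrite mul0r !poly_act0l.
rewrite mulrDl poly_actDl mulrAC poly_actMX IHf poly_actDl poly_actMX poly_actC.
congr (_ + _).
by rewrite mulrC poly_actMC.
Qed.

Lemma poly_actMz f a z : poly_act f (a *~ z) = poly_act f a *~ z.
Proof. by rewrite -!poly_actC -!poly_actM mulrC. Qed.

Lemma poly_act_sum f (I : Type) (r : seq I) (F : I -> A) :
  poly_act f (\sum_(i <- r) F i) = \sum_(i <- r) poly_act f (F i).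
Proof. by elim/big_rec2: _ => [|i x y _ <-]; rewrite ?poly_actr0 ?poly_actDr. Qed.

Lemma poly_actXn n a : poly_act 'X^n a = iter n phi a.
Proof.
elim: n => [|n IHn]; first by rewrite expr0 -[1]/(1%:P) poly_actC mulr1z.
by rewrite exprSr poly_actMX IHn.
Qed.

End AnnihilatorAction.

(** * Recurrences whose characteristic roots lie in the unit disc *)

(** Polynomial bounds are written [n.+2 ^ D] throughout: as the base is at
    least 2, the exponent [D] also absorbs constants, sums and products. *)
Lemma leq_expl e m n : (m <= n)%N -> (m ^ e <= n ^ e)%N.
Proof. by case: e => // e mn; rewrite leq_exp2r. Qed.

Lemma leq_expD x a b m n : (1 < x)%N -> (m <= x ^ a)%N -> (n <= x ^ b)%N ->
  (m + n <= x ^ (a + b).+1)%N.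
Proof.
move=> x1 ma nb; have x0 : (0 < x)%N by apply: ltnW.
apply: (@leq_trans (x ^ (a + b) + x ^ (a + b))).
  apply: leq_add; first by apply: (leq_trans ma); rewrite leq_pexp2l ?leq_addr.
  by apply: (leq_trans nb); rewrite leq_pexp2l ?leq_addl.
by rewrite addnn -mul2n expnS leq_mul2r x1 orbT.
Qed.

Lemma leq_expM x a b m n : (m <= x ^ a)%N -> (n <= x ^ b)%N ->
  (m * n <= x ^ (a + b))%N.
Proof. by move=> ma nb; rewrite expnD leq_mul. Qed.

Section Recurrences.
Local Open Scope ring_scope.

Definition poly_bounded (u : nat -> algC) :=
  exists D : nat, forall i : nat, `|u i| <= ((i.+2 ^ D)%N)%:R.

(** The polynomial [p] in the shift operator, applied to [u]; the equation
    [shiftp p u = 0] is the linear recurrence with characteristic polynomial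
    [p]. *)
Definition shiftp (p : {poly algC}) (u : nat -> algC) (i : nat) : algC :=
  \sum_(j < size p) p`_j * u (i + j)%N.

Lemma shiftp_wide n (p : {poly algC}) u i : (size p <= n)%N ->
  shiftp p u i = \sum_(j < n) p`_j * u (i + j)%N.
Proof.
move=> pn; rewrite /shiftp.
rewrite (big_ord_widen _ (fun j => p`_j * u (i + j)%N) pn) big_mkcond.
by apply: eq_bigr => j _; case: ltnP => // pj; rewrite nth_default ?mul0r.
Qed.

Lemma shiftpXsubC p x u i :
  shiftp (('X - x%:P) * p) u i = shiftp p (fun k => u k.+1 - x * u k) i.
Proof.
rewrite (@shiftp_wide (size p).+1); last first.
  by apply: (leq_trans (size_polyMleq _ _)); rewrite size_XsubC.
transitivity (\sum_(j < (size p).+1) (p * 'X)`_j * u (i + j)%N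
   - \sum_(j < (size p).+1) p`_j * (x * u (i + j)%N)).
  rewrite -sumrB; apply: eq_bigr => j _.
  by rewrite mulrBl coefB coefCM (mulrC 'X) mulrA (mulrC p`_j x) -mulrBl.
rewrite big_ord_recl coefMX eqxx mul0r add0r big_ord_recr /=.
rewrite (@nth_default _ 0 p (size p)) // mul0r addr0 -sumrB.
by apply: eq_bigr => j _; rewrite coefMX /= mulrBr addnS.
Qed.

(** As [|x| <= 1], solving [u k.+1 = x * u k + v k] adds up the moduli of the
    [v k], which raises the degree of a polynomial bound by one. *)
Lemma poly_bounded_step x u : `|x| <= 1 -> poly_bounded (fun k => u k.+1 - x * u k) ->
  poly_bounded u.
Proof.
move=> x1 [D uD]; pose E := Num.bound `|u 0%N|.
have u0E : `|u 0%N| <= E%:R by rewrite ltW // archi_boundP.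
exists (E + (D + 1)).+1 => i.
have {}uD : `|u i| <= E%:R + (i * i.+2 ^ D)%N%:R.
  suff: forall k, (k <= i)%N -> `|u k| <= E%:R + (k * i.+2 ^ D)%N%:R by apply.
  elim=> [|k IHk] ki; first by rewrite mul0n addr0.
  rewrite -[u k.+1](subrK (x * u k)) (le_trans (ler_normD _ _)) //.
  rewrite mulSn natrD addrCA lerD //.
    by apply: (le_trans (uD k)); rewrite ler_nat leq_expl //; lia.
  apply: le_trans (IHk _); last by lia.
  by rewrite normrM ler_piMl.
apply: (le_trans uD); rewrite -natrD ler_nat leq_expD //.
  by apply: (leq_trans (ltnW (ltn_expl E (isT : 1 < 2)%N))); rewrite leq_expl.
by rewrite mulnC leq_expM // expn1; lia.
Qed.

(** The factors of the characteristic polynomial are removed one at a time. *)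
Lemma poly_bounded_rec (s : seq algC) u : (forall x, x \in s -> `|x| <= 1) ->
  (forall i, shiftp (\prod_(x <- s) ('X - x%:P)) u i = 0) -> poly_bounded u.
Proof.
elim: s u => [|x s IHs] u s1 us.
  exists 0%N => i; move: (us i); rewrite big_nil /shiftp size_poly1 big_ord1.
  by rewrite coef1 mul1r addn0 => ->; rewrite normr0 expn0.
apply: (@poly_bounded_step x); first by apply: s1; rewrite mem_head.
apply: IHs => [y ys|i]; first by apply: s1; rewrite in_cons ys orbT.
by rewrite -shiftpXsubC -(us i) big_cons.
Qed.

(** If [|x| > 2], the leading term [|x| ^ d] exceeds the sum
    [(|x| ^ d - 1) / (|x| - 1)] that bounds all the others. *)
Lemma norm_le2_root (f : {poly int}) (x : algC) : f != 0 ->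
  (forall i, `|f`_i| <= 1) -> root (map_poly intr f) x -> `|x| <= 2.
Proof.
move=> f0 f1 /rootP fx; rewrite real_leNgt ?normr_real ?realn //.
apply/negP => x2; have x1 : 1 < `|x| by apply: le_lt_trans x2; rewrite ler1n.
have fS : size f = (size f).-1.+1 by rewrite prednK // size_poly_gt0.
have f1C i : `|(f`_i)%:~R : algC| <= 1 by rewrite -intr_norm -[1]/(1%:~R) ler_int.
have lf : `|(lead_coef f)%:~R : algC| = 1.
  apply/eqP; rewrite eq_le f1C /= -intr_norm -[1]/(1%:~R) ler_int.
  by rewrite -gtz0_ge1 normr_gt0 lead_coef_eq0.
move: fx; rewrite horner_coef size_map_inj_poly //; last exact: intr_inj.
rewrite fS big_ord_recr /= coef_map -/(lead_coef f) => /eqP.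
rewrite addrC addr_eq0 => /eqP /(congr1 Num.norm).
rewrite normrM lf mul1r normrN normrX => xE.
have : `|x| ^+ (size f).-1 <= \sum_(i < (size f).-1) `|x| ^+ i.
  rewrite xE; apply: (le_trans (ler_norm_sum _ _ _)); apply: ler_sum => i _.
  by rewrite coef_map normrM normrX ler_piMl ?exprn_ge0 ?normr_ge0 ?f1C.
move=> xle; have: `|x| ^+ (size f).-1 < `|x| ^+ (size f).-1; last by rewrite ltxx.
apply: le_lt_trans xle _.
rewrite -(ltr_pM2l (_ : 0 < `|x| - 1)) ?subr_gt0 // -subrX1.
apply: (@lt_le_trans _ _ (`|x| ^+ (size f).-1)).
  by rewrite ltrBlDr ltrDl ltr01.
by rewrite ler_peMl ?exprn_ge0 // lerBrDr ltW.
Qed.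

Lemma norm_le1_powers (x : algC) :
  (forall m, (0 < m)%N -> `|x| ^+ m <= 2) -> `|x| <= 1.
Proof.
move=> x2; rewrite real_leNgt ?normr_real ?real1 //; apply/negP => x1.
pose h := `|x| - 1; have h0 : 0 < h by rewrite subr_gt0.
have bern m : 1 + m%:R * h <= `|x| ^+ m.
  elim: m => [|m IHm]; first by rewrite mul0r addr0.
  have xE : `|x| = 1 + h by rewrite /h addrC subrK.
  rewrite exprS {1}xE mulrDl mul1r mulrSr mulrDl mul1r addrA lerD //.
  by rewrite ler_peMr ?(ltW h0) // exprn_ege1 // ltW.
pose m := (Num.bound h^-1).+1.
have hm : 1 < m%:R * h.
  rewrite -ltr_pdivrMr // div1r (lt_trans (archi_boundP _)) ?invr_ge0 ?(ltW h0) //.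
  by rewrite ltr_nat.
have := lt_le_trans _ (le_trans (bern m) (x2 m isT)).
by move=> /(_ 2); rewrite ltxx -[X in X < _]/(1 + 1) ltrD2l => /(_ hm).
Qed.

End Recurrences.

(** * Endomorphisms whose powers satisfy small relations *)
Section ShortOrbits.
Local Open Scope ring_scope.

(** The remainders of ['X^n] modulo [D] satisfy, coefficient by coefficient,
    the recurrence with characteristic polynomial [D], because ['X^i * D] is
    zero modulo [D]. *)
Lemma rmodXn_poly_bounded (D : {poly int}) k : D \is monic ->
  (forall x : algC, root (map_poly intr D) x -> `|x| <= 1) ->
  exists E, forall n, (`|((Pdiv.Ring.rmodp 'X^n D)`_k)%R| <= n.+2 ^ E)%N.
Proof.
move=> monD rootD; pose r n := Pdiv.Ring.rmodp 'X^n D.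
pose u n : algC := ((r n)`_k)%:~R.
suff [E uE] : poly_bounded u.
  exists E => n; have := uE n; rewrite /u -intr_norm -[_%:R]/((_ : nat)%:Z%:~R).
  by rewrite ler_int -abszE lez_nat.
have monDC : map_poly intr D \is @monic algC by apply: monic_map.
have [s sE] := closed_field_poly_normal (map_poly (intr : int -> algC) D).
rewrite (monicP monDC) scale1r in sE.
apply: (@poly_bounded_rec s) => [x xs|i].
  by apply: rootD; rewrite sE root_prod_XsubC.
rewrite -sE /shiftp size_map_inj_poly //; last exact: intr_inj.
transitivity (((\sum_(j < size D) D`_j *: r (i + j)%N)`_k)%:~R : algC).
  rewrite coef_sum rmorph_sum /=; apply: eq_bigr => j _.
  by rewrite coefZ coef_map rmorphM.
suff -> : \sum_(j < size D) D`_j *: r (i + j)%N = 0 by rewrite coef0.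
transitivity (Pdiv.Ring.rmodp ('X^i * D) D); last exact: Pdiv.RingMonic.rmodp_mull.
rewrite -[in 'X^i * D](coefK D) poly_def mulr_sumr Pdiv.RingMonic.rmodp_sum //.
apply: eq_bigr => j _.
by rewrite -scalerAr Pdiv.RingMonic.rmodpZ // -exprD.
Qed.

Variables (A : zmodType) (phi : A -> A) (X : seq A).
Hypothesis phiD : forall a b, phi (a + b) = phi a + phi b.
Hypothesis genX : forall a, exists z : nat -> int,
  a = \sum_(i < size X) X`_i *~ z i.
Hypothesis small_relation : forall m a, (0 < m)%N -> exists f : {poly int},
  [/\ f != 0, forall i, `|f`_i| <= 1 &
      \sum_(i < size f) iter (m * i) phi a *~ f`_i = 0].

Let annihilates (f : {poly int}) := forall a, poly_act phi f a = 0.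

Let annihilates_gen f : (forall i, (i < size X)%N -> poly_act phi f X`_i = 0) ->
  annihilates f.
Proof.
move=> fX a; have [z ->] := genX a; rewrite poly_act_sum // big1 // => i _.
by rewrite poly_actMz // fX // mul0rz.
Qed.

Let poly_act_comp_Xn f m a :
  poly_act phi (f \Po 'X^m) a = \sum_(i < size f) iter (m * i) phi a *~ f`_i.
Proof.
rewrite comp_polyE; elim/big_rec2: _ => [|i x h _ hx]; first by rewrite poly_act0l.
by rewrite poly_actDl hx -mul_polyC mulrC poly_actMC // -exprM poly_actXn.
Qed.

(** The product, over the generators, of their relations for [phi^m].  A
    nonzero coefficient of a relation is 1 or -1, so leading coefficients are
    units and stay so in the product. *)
Let small_annihilator m : (0 < m)%N -> exists f : {poly int},
  [/\ `|lead_coef f| = 1, annihilates f & forall x : algC,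
      root (map_poly intr f) x -> `|x| ^+ m <= 2].
Proof.
move=> m0; suff [f [f1 fX fr]] : exists f : {poly int},
  [/\ `|lead_coef f| = 1, forall i, (i < size X)%N -> poly_act phi f X`_i = 0 &
      forall x : algC, root (map_poly intr f) x -> `|x| ^+ m <= 2].
  by exists f; split=> //; apply: annihilates_gen.
elim: (X) => [|b Y [f [f1 fY fr]]].
  exists 1; rewrite lead_coef1 normr1; split=> // x.
  by rewrite rmorph1 (negPf (root1 x)).
have [h [h0 hle hb]] := small_relation b m0.
exists (f * (h \Po 'X^m)); split.
- rewrite lead_coefM normrM f1 mul1r lead_coef_comp ?size_polyXn //.
  rewrite lead_coefXn expr1n mulr1.
  by apply/eqP; rewrite eq_le hle -gtz0_ge1 normr_gt0 lead_coef_eq0.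
- case=> [|i] iY; first by rewrite poly_actM // poly_act_comp_Xn hb poly_actr0.
  by rewrite mulrC poly_actM // fY ?poly_actr0.
- move=> x; rewrite rmorphM rootM => /orP[/fr //|].
  rewrite /= map_comp_poly map_polyXn root_comp hornerXn => /norm_le2_root.
  by rewrite normrX; apply.
Qed.

(** A nonzero annihilator of least degree divides every annihilator up to a
    constant factor, and by Gauss's lemma its primitive part [D] divides it
    over the integers.  Dividing the annihilators of [small_annihilator], [D]
    is monic and its roots satisfy [|x| ^ m <= 2] for all positive [m].  The
    content [c] survives because [A] may have torsion. *)
Let minimal_annihilator : exists (D : {poly int}) (c : int),
  [/\ D \is monic, c != 0, annihilates (c *: D) &
      forall x : algC, root (map_poly intr D) x -> `|x| <= 1].
Proof.
have [n /asboolP[f0 [fnz fann fn]] nmin] : exists2 n,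
    `[< exists f : {poly int}, [/\ f != 0, annihilates f & size f = n] >] &
    forall k, `[< exists f : {poly int}, [/\ f != 0, annihilates f & size f = k] >] ->
      (n <= k)%N.
  have ex : exists n, `[< exists f : {poly int}, [/\ f != 0, annihilates f & size f = n] >].
    have [f [f1 fa _]] := small_annihilator (isT : 0 < 1)%N.
    exists (size f); apply/asboolP; exists f; split=> //.
    by rewrite -lead_coef_eq0 -normr_eq0 f1.
  by case: (ex_minnP ex) => n nP nmin; exists n.
have div f : annihilates f -> exists r, f = zprimitive f0 * r.
  move=> fa; suff /dvdpP_int[r ->] : f0 %| f by exists r.
  have fE := Pdiv.Idomain.divp_eq f f0.
  rewrite /dvdp; apply/negP => /negP r0.
  suff: (n <= size (f %% f0)%R)%N by rewrite -fn leqNgt Pdiv.CommonIdomain.ltn_modpN0.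
  apply: nmin; apply/asboolP; exists (f %% f0); split=> // a.
  have -> : f %% f0 = lead_coef f0 ^+ scalp f f0 *: f - f %/ f0 * f0.
    by rewrite fE addrC addKr.
  rewrite poly_actBl // poly_actM // fann poly_actr0 // -mul_polyC mulrC.
  by rewrite poly_actMC // fa mul0rz subrr.
exists (zprimitive f0), (zcontents f0); rewrite zcontents_eq0 fnz -zpolyEprim.
split=> //.
  have [f [f1 /div[r fE] _]] := small_annihilator (isT : 0 < 1)%N.
  move: f1; rewrite fE lead_coefM normrM.
  have : 0 < lead_coef (zprimitive f0) by rewrite -sgz_gt0 sgz_lead_primitive fnz.
  rewrite monicE; move: (lead_coef (zprimitive f0)) (lead_coef r).
  move=> x y x0; rewrite gtr0_norm //; have := normr_ge0 y.
  case: x x0 => // x _; case: `|y| => // z _ [] /eqP.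
  by rewrite muln_eq1 => /andP[/eqP->].
move=> x x0; apply: norm_le1_powers => m m0.
have [f [_ /div[r fE] fr]] := small_annihilator m0; apply: fr.
by rewrite fE rmorphM rootM x0.
Qed.

(** Divide ['X^n] by [D].  The remainder acts through the first [size D]
    iterates, with polynomially bounded coefficients; the multiple of [D] acts
    with values in the image of [D], which [c] kills, so that there coordinates
    matter only modulo [c]. *)
Lemma orbit_short : forall a, exists (Y : seq A) (E : nat), forall n,
  exists2 r : nat -> int, iter n phi a = \sum_(k < size Y) Y`_k *~ r k &
    forall k, (`|r k| <= n.+2 ^ E)%N.
Proof.
move=> a; have [D [c [monD c0 Dc Droot]]] := minimal_annihilator.
have [F rF] : exists F, forall n k,
    (`|((Pdiv.Ring.rmodp 'X^n D)`_k)%R| <= n.+2 ^ F)%N.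
  suff [F rF] : exists F, forall n k, (k < size D)%N ->
      (`|((Pdiv.Ring.rmodp 'X^n D)`_k)%R| <= n.+2 ^ F)%N.
    exists F => n k; case: (ltnP k (size D)) => [/rF//|kD].
    rewrite nth_default ?absz0 // (leq_trans _ kD) // ltnW //.
    by rewrite Pdiv.Ring.ltn_rmodpN0 // monic_neq0.
  elim: (size D) => [|d [F rF]]; first by exists 0%N.
  have [G rG] := rmodXn_poly_bounded d monD Droot.
  exists (maxn F G) => n k; rewrite ltnS leq_eqVlt => /orP[/eqP->|/rF kF].
    by apply: (leq_trans (rG n)); rewrite leq_pexp2l ?leq_maxr.
  by apply: (leq_trans (kF n)); rewrite leq_pexp2l ?leq_maxl.
pose Y1 := [seq iter k phi a | k <- iota 0 (size D)].
pose Y2 := [seq poly_act phi D b | b <- X].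
exists (Y1 ++ Y2), (maxn F `|c|%N) => n.
pose r := Pdiv.Ring.rmodp 'X^n D.
have XE : 'X^n = Pdiv.Ring.rdivp 'X^n D * D + r by apply: Pdiv.RingMonic.rdivp_eq.
have [z zE] := genX (poly_act phi (Pdiv.Ring.rdivp 'X^n D) a).
exists (fun k => if (k < size D)%N then r`_k else (z (k - size D)%N %% c)%Z); last first.
  move=> k; case: ifP => _.
    by apply: (leq_trans (rF n k)); rewrite leq_pexp2l ?leq_maxl.
  apply: (@leq_trans (n.+2 ^ `|c|)); last by rewrite leq_pexp2l ?leq_maxr.
  apply: (@leq_trans `|c|%N); first by have := ltz_mod (z (k - size D)%N) c0; lia.
  by apply: ltnW; apply: ltn_expl.
have s1 : size Y1 = size D by rewrite size_map size_iota.
rewrite -poly_actXn // XE poly_actDl // addrC mulrC poly_actM // zE.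
rewrite poly_act_sum // size_cat.
rewrite big_split_ord /=; congr (_ + _).
  rewrite (@poly_act_wide _ _ (size Y1)) ?s1; last first.
    by rewrite ltnW // Pdiv.Ring.ltn_rmodpN0 // monic_neq0.
  apply: eq_bigr => i _; rewrite ltn_ord nth_cat s1 ltn_ord.
  by rewrite (nth_map 0%N) ?size_iota // nth_iota.
rewrite size_map; apply: eq_bigr => i _.
rewrite nth_cat s1 ltnNge leq_addr /= addKn (nth_map 0) // poly_actMz //.
rewrite {1}(divz_eq (z i) c) mulrzDr [(_ %/ _)%Z * _]mulrC mulrzA.
have : poly_act phi (c *: D) X`_i = 0 by [].
by rewrite -mul_polyC mulrC poly_actMC // => ->; rewrite mul0rz add0r.
Qed.

End ShortOrbits.

Local Open Scope classical_set_scope.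
Local Open Scope group_scope.

(** * Subgroups, generation and word balls *)
Section Subgroups.
Variable G : groupType.
Implicit Types (x y z t b c g h : G) (H K M N : set G) (C : seq G).

Definition subgroup H := H 1 /\ forall x y, H x -> H y -> H (x * y^-1).

Section SubgroupTheory.
Variable H : set G.
Hypothesis sH : subgroup H.

Lemma sub1g : H 1. Proof. by case: sH. Qed.

Lemma subVg x : H x -> H x^-1.
Proof. by case: sH => H1 HD Hx; rewrite -[x^-1]mul1g; apply: HD. Qed.

Lemma subMg x y : H x -> H y -> H (x * y).
Proof. by move=> Hx /subVg Hy; rewrite -[y]invgK; apply: (proj2 sH). Qed.

Lemma subXg x n : H x -> H (x ^+ n).
Proof.
by move=> Hx; elim: n => [|n IHn]; rewrite ?expgS; [apply: sub1g|apply: subMg].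
Qed.

Lemma subVgE x : H x^-1 -> H x.
Proof. by move=> /subVg; rewrite invgK. Qed.

Lemma subMgl x y : H x -> H (x * y) -> H y.
Proof. by move=> /subVg Hx Hxy; rewrite -(mulKg x y); apply: subMg. Qed.

Lemma subJg x y : H x -> H y -> H (x ^ y).
Proof. by move=> Hx Hy; apply: subMg; [apply: subVg|apply: subMg]. Qed.

Lemma subRg x y : H x -> H y -> H [~ x, y].
Proof. by move=> Hx Hy; apply: subMg; [apply: subVg|apply: subJg]. Qed.

End SubgroupTheory.

Definition generated (A : set G) : set G :=
  [set x | forall H, subgroup H -> A `<=` H -> H x].

Lemma subgroup_generated A : subgroup (generated A).
Proof.
split=> [H sH _|x y gx gy H sH AH]; first exact: (sub1g sH).
by apply: (proj2 sH); [apply: gx|apply: gy].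
Qed.

Lemma sub_generated A : A `<=` generated A.
Proof. by move=> x Ax H _ AH; apply: AH. Qed.

Lemma generated_sub A H : subgroup H -> A `<=` H -> generated A `<=` H.
Proof. by move=> sH AH x; apply. Qed.

Lemma generated_mono (A B : set G) : A `<=` B -> generated A `<=` generated B.
Proof.
by move=> AB; apply: generated_sub (@subgroup_generated B) _ => x /AB /sub_generated.
Qed.

Lemma subgroup1 : subgroup [set 1].
Proof. by split=> // x y -> ->; rewrite /= invg1 mulg1. Qed.

Lemma subgroupI H K : subgroup H -> subgroup K -> subgroup (H `&` K).
Proof.
move=> sH sK; split=> [|x y [Hx Kx] [Hy Ky]].
  by split; [apply: (sub1g sH)|apply: (sub1g sK)].
by split; [apply: (proj2 sH)|apply: (proj2 sK)].
Qed.

(** The neutral element is a letter, so that the words of length [n] include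
    the shorter ones and balls are increasing. *)
Definition letters C := 1 :: C ++ [seq c^-1 | c <- C].

Lemma letters_inv C c : c \in letters C -> c^-1 \in letters C.
Proof.
rewrite !inE !mem_cat => /or3P[/eqP->|cC|/mapP[d dC ->]].
- by rewrite invg1 eqxx.
- by rewrite map_f ?orbT.
- by rewrite invgK dC ?orbT.
Qed.

Lemma mem_letters C c : c \in C -> c \in letters C.
Proof. by move=> cC; rewrite !inE mem_cat cC ?orbT. Qed.

Lemma letters_sub C H : subgroup H -> [set` C] `<=` H ->
  forall c, c \in letters C -> H c.
Proof.
move=> sH CH c; rewrite !inE !mem_cat => /or3P[/eqP->|/CH//|/mapP[d /CH Hd ->]].
  exact: (sub1g sH).
exact: (subVg sH).
Qed.

Fixpoint ball C n : set G :=
  if n is n'.+1 then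
    [set x | exists2 y, ball C n' y & exists2 c, c \in letters C & x = y * c]
  else [set 1].

Lemma ballS C n x : ball C n x -> ball C n.+1 x.
Proof. by exists x => //; exists 1; rewrite ?mulg1 // mem_head. Qed.

Lemma ball_le C m n x : (m <= n)%N -> ball C m x -> ball C n x.
Proof. by move=> /subnK <- xm; elim: (n - m)%N => //= k; apply: ballS. Qed.

Lemma ball1 C n : ball C n 1.
Proof. exact: (@ball_le C 0). Qed.

Lemma ballM C m n x y : ball C m x -> ball C n y -> ball C (m + n) (x * y).
Proof.
move=> xm; elim: n y => [|n IHn] y; first by move=> ->; rewrite mulg1 addn0.
case=> z zn [c cC ->]; rewrite addnS mulgA; exists (x * z); first exact: IHn.
by exists c.
Qed.

Lemma ball_letter C c : c \in letters C -> ball C 1 c.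
Proof. by move=> cC; exists 1 => //; exists c; rewrite ?mul1g. Qed.

Lemma ball_mem C c : c \in C -> ball C 1 c.
Proof. by move/mem_letters/ball_letter. Qed.

Lemma ballV C n x : ball C n x -> ball C n x^-1.
Proof.
elim: n x => [|n IHn] x; first by move=> ->; rewrite invg1.
case=> y /IHn yn [c cC ->]; rewrite invgM -addn1 addnC.
by apply: ballM => //; apply/ball_letter/letters_inv.
Qed.

Lemma ballX C n m x : ball C n x -> ball C (m * n) (x ^+ m).
Proof.
move=> xn; elim: m => [|m IHm]; first exact: ball1.
by rewrite mulSn expgS; apply: ballM.
Qed.

Lemma ball_trans C C' k n x : (forall c, c \in C -> ball C' k c) ->
  ball C n x -> ball C' (n * k) x.
Proof.
move=> CC'; elim: n x => [|n IHn] x; first by move=> ->; apply: ball1.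
case=> y /IHn yn [c cC ->]; rewrite mulSn addnC; apply: ballM => //.
move: cC; rewrite !inE !mem_cat => /or3P[/eqP->|/CC'//|/mapP[d /CC' dC ->]].
  exact: ball1.
exact: ballV.
Qed.

Lemma ball_generated C n x : ball C n x -> generated [set` C] x.
Proof.
have sg := @subgroup_generated [set` C].
elim: n x => [|n IHn] x; first by move=> ->; apply: (sub1g sg).
case=> y /IHn yn [c cC ->]; apply: (subMg sg) => //.
by apply: (letters_sub sg _ cC); apply: sub_generated.
Qed.

Lemma generated_ball C x : generated [set` C] x -> exists n, ball C n x.
Proof.
move: x; apply: (@generated_sub _ [set x | exists n, ball C n x]); last first.
  by move=> c /ball_mem; exists 1%N.
split=> [|y z [m ym] [n /ballV zn]]; first by exists 0%N.
by exists (m + n)%N; apply: ballM.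
Qed.

Lemma finite_ball C n : exists s : seq G, forall x, ball C n x -> x \in s.
Proof.
elim: n => [|n [s sP]]; first by exists [:: 1] => x ->; rewrite inE.
exists [seq y * c | y <- s, c <- letters C] => x [y /sP ys [c cC ->]].
by apply/allpairsP; exists (y, c).
Qed.

Lemma ball_uniform C C' : [set` C] `<=` generated [set` C'] ->
  exists k, forall c, c \in C -> ball C' k c.
Proof.
elim: C => [|c C IHC] CC'; first by exists 0%N.
have [k kC] := IHC (fun x xC => CC' x (mem_behead (s := c :: C) xC)).
have [m cm] := generated_ball (CC' c (mem_head c C)).
exists (maxn k m) => d; rewrite inE => /orP[/eqP->|/kC].
  by apply: ball_le cm; rewrite leq_maxr.
by apply: ball_le; rewrite leq_maxl.
Qed.

Definition fin_gen H := exists C, generated [set` C] = H.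

Lemma fin_gen_subgroup H : fin_gen H -> subgroup H.
Proof. by case=> C <-; apply: subgroup_generated. Qed.

Definition normal_in H K := forall x g, H x -> K g -> H (x ^ g).

Definition abelian_mod N H := forall x y, H x -> H y -> N [~ x, y].

Lemma abelian_mod_normal N M H : subgroup M -> abelian_mod N H -> N `<=` M ->
  M `<=` H -> normal_in M H.
Proof.
move=> sM abN NM MH x g Mx Hg.
rewrite -(mulVKg x (x ^ g)) -commgEl; apply: (subMg sM) => //.
by apply/NM/abN => //; apply: MH.
Qed.

Definition finite_index M H := exists s : seq G, forall h, H h ->
  exists2 r, r \in s & H r /\ M (h * r^-1).

(** Reidemeister-Schreier rewriting: if [r i] represents the coset of the
    [i]-th prefix of the word [y 1 ... y n], the word is the product of the
    elements [r (i-1) * y i * (r i)^-1] of [M], followed by [r n].  The number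
    of factors is the length of the word, which controls lengths as well as
    generation. *)
Lemma schreier C M : subgroup M -> M `<=` generated [set` C] ->
  finite_index M (generated [set` C]) -> exists s C' : seq G,
  generated [set` C'] = M /\ forall n x,
    ball C n x -> exists2 r, r \in s & ball C' n (x * r^-1).
Proof.
set H := generated _ => sM MH [s0 s0P]; pose s := 1 :: s0.
have sH : subgroup H by apply: subgroup_generated.
pose C' := [seq z <- [seq y * r^-1 | y <- [seq r * c | r <- s, c <- letters C],
  r <- s] | `[< M z >]].
have C'P r c r' : r \in s -> c \in letters C -> r' \in s ->
    M (r * c * r'^-1) -> r * c * r'^-1 \in C'.
  move=> rs cC r's Mz; rewrite mem_filter; apply/andP; split; first exact/asboolP.
  apply/allpairsP; exists (r * c, r'); split=> //.
  by apply/allpairsP; exists (r, c).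
have sC n x : ball C n x -> exists2 r, r \in s & H r /\ ball C' n (x * r^-1).
  elim: n x => [|n IHn] x.
    move=> ->; exists 1; first exact: mem_head.
    by rewrite mulgV; split; [apply: (sub1g sH)|].
  case=> y /IHn[r rs [Hr yr]] [c cC ->].
  have Hrc : H (r * c).
    by apply: (subMg sH) => //; apply: (letters_sub sH _ cC); apply: sub_generated.
  have [r' r's [Hr' Mr']] := s0P _ Hrc.
  have r's1 : r' \in s by rewrite inE r's orbT.
  exists r' => //; split=> //.
  have -> : y * c * r'^-1 = y * r^-1 * (r * c * r'^-1) by rewrite !mulgA mulgVK.
  by exists (y * r^-1) => //; exists (r * c * r'^-1) => //; apply/mem_letters/C'P.
exists s, C'; split; last first.
  by move=> n x /sC[r rs [_ rb]]; exists r.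
apply/seteqP; split.
  by apply: generated_sub => // x /=; rewrite mem_filter => /andP[/asboolP].
move=> x Mx; have [n xn] := generated_ball (MH x Mx).
have [r rs [_ /ball_generated rb]] := sC n x xn.
rewrite -(mulgVK r x); apply: (subMg (@subgroup_generated _)) => //.
have xrM : M (x * r^-1).
  apply: generated_sub rb => // y /=.
  by rewrite mem_filter => /andP[/asboolP].
have Mr : M r by apply: (subVgE sM); apply: (subMgl sM Mx).
apply: sub_generated => /=; have := C'P r 1 1 rs (mem_head _ _) (mem_head _ _).
by rewrite invg1 !mulg1; apply.
Qed.

Lemma fin_gen_finite_index M H : subgroup M -> M `<=` H -> finite_index M H ->
  fin_gen H -> fin_gen M.
Proof.
move=> sM MH fM [C CH]; rewrite -CH in MH fM.
by have [s [C' [C'M _]]] := schreier sM MH fM; exists C'.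
Qed.

Lemma finite_index_trans K M H : subgroup H -> subgroup K -> K `<=` M -> M `<=` H ->
  finite_index K M -> finite_index M H -> finite_index K H.
Proof.
move=> sH sK KM MH [s sP] [s' s'P].
exists [seq r * r' | r <- s, r' <- s'] => h Hh.
have [r' r's [Hr' /sP[r rs [Mr Kr]]]] := s'P h Hh.
exists (r * r'); first by apply/allpairsP; exists (r, r').
by rewrite invgM mulgA; split=> //; apply: (subMg sH) => //; apply: MH.
Qed.

Lemma finite_index_fun (T : finType) (f : G -> T) M H :
  (forall x y, H x -> H y -> f x = f y -> M (x * y^-1)) -> finite_index M H.
Proof.
move=> fM; suff [s sP] : exists s : seq G, forall h, H h -> f h \in enum T ->
    exists2 r, r \in s & H r /\ M (h * r^-1).
  by exists s => h Hh; apply: sP => //; rewrite mem_enum.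
elim: (enum T) => [|a l [s sP]]; first by exists [::].
case: (pselect (exists2 r, H r & f r = a)) => [[r Hr fr]|nr].
  exists (r :: s) => h Hh; rewrite inE => /orP[/eqP fh|/(sP h Hh)[r' r's]].
    by exists r; rewrite ?mem_head //; split=> //; apply: fM => //; rewrite fr.
  by exists r' => //; rewrite inE r's orbT.
exists s => h Hh; rewrite inE => /orP[/eqP fh|/(sP h Hh)//].
by case: nr; exists h.
Qed.

Definition expz x (k : int) : G :=
  match k with Posz n => x ^+ n | Negz n => x ^- n.+1 end.

Lemma expzS x k : expz x (k + 1)%R = expz x k * x.
Proof.
case: k => n; first by rewrite -PoszD addn1 /= expgSr.
rewrite NegzE; case: n => [|n]; first by rewrite addNr /= expg1 mulVg.
have -> : (- n.+2%:Z + 1)%R = Negz n by rewrite NegzE; lia.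
have -> : (- n.+2%:Z)%R = Negz n.+1 by rewrite NegzE.
by rewrite /= [x ^+ n.+2]expgS invgM mulgVK.
Qed.

Lemma expzP x k : expz x (k - 1)%R = expz x k * x^-1.
Proof. by rewrite -[k in RHS](subrK 1%R) expzS mulgK. Qed.

Lemma expzD x k l : expz x (k + l)%R = expz x k * expz x l.
Proof.
elim: l => [|n IHn|n IHn]; first by rewrite addr0 mulg1.
  by rewrite -addn1 PoszD addrA !expzS IHn mulgA.
by rewrite -addn1 PoszD opprD addrA !expzP IHn mulgA.
Qed.

Lemma expzN x k : expz x (- k)%R = (expz x k)^-1.
Proof.
by apply: (mulIg (expz x k)); rewrite mulVg -expzD addNr.
Qed.

Lemma expzM x k l : expz x (k * l)%R = expz (expz x k) l.
Proof.
elim: l => [|n IHn|n IHn]; first by rewrite mulr0.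
  by rewrite -addn1 PoszD expzS -IHn -expzD mulrDr mulr1.
by rewrite -addn1 PoszD opprD expzP -IHn -expzN -expzD mulrBr mulr1.
Qed.

Lemma subzg H x k : subgroup H -> H x -> H (expz x k).
Proof.
by move=> sH Hx; case: k => n; [|apply: (subVg sH)]; apply: (subXg sH).
Qed.

Lemma ball_expz C n x k : ball C n x -> ball C (`|k| * n) (expz x k).
Proof. by move=> xn; case: k => m; [|apply: ballV]; apply: ballX. Qed.

(** The powers of [t] that lie in [N] are the powers of one of them; the bound
    on [q] makes this harmless for word lengths. *)
Lemma cyclic_subgroup N t : subgroup N -> exists2 e, N (expz t e) &
  forall k, N (expz t k) -> exists2 q, (`|q| <= `|k|)%N & expz t k = expz (expz t e) q.
Proof.
move=> sN.
case: (pselect (exists n, (0 < n)%N && `[< N (t ^+ n) >])) => [ex|nex].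
  case: (ex_minnP ex) => e /andP[e0 /asboolP Ne] emin.
  exists e => // k Nk; exists (k %/ e)%Z; first by nia.
  rewrite -expzM mulrC; congr expz; rewrite {1}(divz_eq k e).
  suff: (k %% e)%Z = 0%R by move=> ->; rewrite addr0.
  have ke : (0 <= (k %% e)%Z < e)%R by rewrite modz_ge0 ?ltz_pmod //; lia.
  have Nr : N (expz t (k %% e)%Z).
    rewrite /modz expzD; apply: (subMg sN) => //.
    by rewrite mulrC -mulrN expzM; apply: (subzg _ sN).
  move: ke Nr; case: (k %% e)%Z => // r /andP[_ re] Nr.
  case: (posnP r) => [->//|r0].
  have := emin r; rewrite r0 /=; move: (asboolT Nr) => /= -> /(_ isT).
  by move: re; rewrite ltz_nat ltnNge => /negPf ->.
exists 0%R; first exact: (sub1g sN).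
move=> k Nk; exists 0%R => //; suff -> : k = 0%R by [].
case: k Nk => [[|n]|n] // Nk; case: nex; exists n.+1; apply/andP; split=> //.
  exact/asboolP.
by apply/asboolP; apply: (subVgE sN).
Qed.

End Subgroups.

(** * Finite generation of kernels in the absence of free semigroups *)
Section Milnor.
Variable G : groupType.
Implicit Types (x y z t b c g h : G) (H K M N : set G) (C : seq G) (u v : seq bool).

Definition word_eval x y u : G := foldr (fun a z => (if a then x else y) * z) 1 u.

Definition no_free_semigroup := forall x y, exists u v,
  [/\ size u = size v, u <> v & word_eval x y u = word_eval x y v].

(** The product of the [b ^ (t ^+ j)] over the positions [j >= 1] at which [u]
    is true.  Up to a power of [t], it is the value of the word [u] at
    [t^-1 * b] and [t^-1], so that equalities between words of the same length
    become equalities between such products. *)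
Fixpoint conj_word t b u : G :=
  if u is a :: u' then ((if a then b else 1) * conj_word t b u') ^ t else 1.

Lemma word_eval_conj_word t b u :
  word_eval (t^-1 * b) t^-1 u = conj_word t b u * t ^- size u.
Proof.
elim: u => [|a u IHu] /=; first by rewrite invg1 mulg1.
rewrite IHu expgSr invgM conjgE !mulgA mulgK.
by congr (_ * _ * _); case: a; rewrite ?mulg1.
Qed.

(** After removal of the longest common prefix, one of the words starts with
    [t^-1 * b] and the other with [t^-1]. *)
Lemma conj_word_relation t b : no_free_semigroup -> exists u v,
  size u = size v /\ b * conj_word t b u = conj_word t b v.
Proof.
move=> /(_ (t^-1 * b) t^-1)[u [v [suv uv]]]; rewrite !word_eval_conj_word suv.
move=> /mulIg; elim: u v suv uv => [|a u IHu] [|a' v] //= [suv] uv /conjg_inj.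
case: (eqVneq a a') uv => [<- uv /mulgI|].
  by apply: IHu => // E; apply: uv; rewrite E.
case: a; case: a' => // _ _; rewrite mul1g => E; first by exists u, v.
by exists v, u.
Qed.

Lemma conj_word_sub t b u g M : subgroup M ->
  (forall j, (0 < j <= size u)%N -> M ((b ^ (t ^+ j)) ^ g)) ->
  M (conj_word t b u ^ g).
Proof.
move=> sM; elim: u g => [|a u IHu] g Mj /=; first by rewrite conj1g; apply: (sub1g sM).
rewrite -conjgM conjMg; apply: (subMg sM).
  case: (a); last by rewrite conj1g; apply: (sub1g sM).
  by have := Mj 1%N isT; rewrite expg1 -conjgM.
apply: IHu => j /andP[j0 ju]; have := Mj j.+1; rewrite expgSr !conjgM; apply.
by rewrite ltnS.
Qed.

Hypothesis nfs : no_free_semigroup.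

(** The relation writes [b] in terms of its conjugates by [t], ..., [t ^+ n].
    Conjugated by [t^-1 ^+ i], it yields the conjugate of [b] by [t^-1 ^+ i]
    from the next [n] ones. *)
Lemma conj_half_line t b : exists n, forall M, subgroup M ->
  (forall j, (j <= n)%N -> M (b ^ (t ^+ j))) -> forall i, M (b ^ (t^-1 ^+ i)).
Proof.
have [u [v [suv E]]] := conj_word_relation t b nfs.
exists (size u) => M sM Mj i.
suff {}: forall k i, (i <= k)%N -> M (b ^ (t^-1 ^+ i)) by move/(_ i i); apply.
clear i.
elim=> [|k IHk] i; first by rewrite leqn0 => /eqP->; apply: (Mj 0%N).
rewrite leq_eqVlt => /orP[/eqP->|/IHk//].
have -> : b = conj_word t b v * (conj_word t b u)^-1 by rewrite -E mulgK.
have Mj' j : (0 < j <= size u)%N -> M ((b ^ (t ^+ j)) ^ (t^-1 ^+ k.+1)).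
  move=> /andP[j0 ju]; rewrite -conjgM expVgn.
  case: (leqP j k.+1) => jk.
    rewrite -[k.+1](subnK jk) expgnDr invgM mulgA mulgV mul1g -expVgn.
    by apply: IHk; lia.
  by rewrite -[j in _ ^+ j](subnK (ltnW jk)) expgnDr mulgK; apply: Mj; lia.
rewrite conjMg conjVg; apply: (subMg sM); last apply: (subVg sM).
  by apply: conj_word_sub => //; rewrite -suv.
exact: conj_word_sub.
Qed.

Lemma conj_line t b : exists L : seq G,
  (forall x, x \in L -> exists k, x = b ^ expz t k) /\
  forall M, subgroup M -> [set` L] `<=` M -> forall k, M (b ^ expz t k).
Proof.
have [n nP] := conj_half_line t b; have [m mP] := conj_half_line t^-1 b.
exists ([seq b ^ (t ^+ j) | j <- iota 0 (n + 1)] ++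
        [seq b ^ (t^-1 ^+ j) | j <- iota 0 (m + 1)]); split.
  move=> x; rewrite mem_cat => /orP[] /mapP[j _ ->]; first by exists j.
  by exists (- j%:Z)%R; rewrite expzN expVgn.
move=> M sM LM; have Mn := nP M sM; have Mm := mP M sM.
have {}Mn : forall i, M (b ^ (t^-1 ^+ i)).
  apply: Mn => j jn; apply: LM; rewrite /= mem_cat; apply/orP; left.
  by apply: map_f; rewrite mem_iota addn1.
have {}Mm : forall i, M (b ^ (t ^+ i)).
  move=> i; rewrite -[t]invgK; apply: Mm => j jm; apply: LM.
  rewrite /= mem_cat; apply/orP; right.
  by apply: map_f; rewrite mem_iota addn1.
by case=> k; [apply: Mm|rewrite /= -expVgn; apply: Mn].
Qed.

Lemma conj_lines t (B : seq G) : exists L : seq G,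
  (forall x, x \in L -> exists2 b, b \in B & exists k, x = b ^ expz t k) /\
  forall M, subgroup M -> [set` L] `<=` M ->
    forall b k, b \in B -> M (b ^ expz t k).
Proof.
elim: B => [|b B [L [LB BL]]]; first by exists [::]; split.
have [L' [Lb bL]] := conj_line t b; exists (L' ++ L); split.
  move=> x; rewrite mem_cat => /orP[/Lb[k ->]|/LB[d dB xE]].
    by exists b; [apply: mem_head|exists k].
  by exists d => //; rewrite inE dB orbT.
move=> M sM LM d k; rewrite inE => /orP[/eqP->|].
  by apply: bL => // x xL; apply: LM; rewrite /= mem_cat xL.
by apply: BL => // x xL; apply: LM; rewrite /= mem_cat xL orbT.
Qed.

Lemma subgroup_cyclic_ext M t : subgroup M ->
  (forall x k, M x -> M (x ^ expz t k)) ->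
  subgroup [set h | exists k, M (h * (expz t k)^-1)].
Proof.
move=> sM MJ; split=> [|x y /= [k Mx] [l My]].
  by exists 0%R; rewrite /= mulgV; apply: (sub1g sM).
exists (k - l)%R; rewrite expzD expzN invgM invgK.
have -> : x * y^-1 * (expz t l * (expz t k)^-1) =
  (x * (expz t k)^-1) * ((y * (expz t l)^-1)^-1 ^ expz t (l - k)%R).
  by rewrite conjgE expzD expzN !invgM !invgK !mulgA !mulgVK.
by apply: (subMg sM) => //; apply: MJ; apply: (subVg sM).
Qed.

(** Write the generators of [H] as [b * t^k] with [b] in [N].  The conjugates
    of these [b] by powers of [t] generate a subgroup [M0] of [N], finitely many
    of them suffice by [conj_lines], and every element of [H] is in [M0 * t^k]
    for some [k].  So [N] is generated by [M0] and the powers of [t] in [N]. *)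
Lemma fin_gen_cyclic_kernel H N t : fin_gen H -> subgroup N -> N `<=` H ->
  normal_in N H -> H t -> (forall h, H h -> exists k, N (h * (expz t k)^-1)) ->
  fin_gen N.
Proof.
move=> fgH sN NH nN Ht tH; have sH := fin_gen_subgroup fgH; case: fgH => C CH.
have CsH c : c \in C -> H c by move=> cC; rewrite -CH; apply: sub_generated.
have [B [BN CB]] : exists B : seq G, (forall b, b \in B -> N b) /\
    forall c, c \in C -> exists2 b, b \in B & exists k, c = b * expz t k.
  elim: (C) CsH => [|c C' IHC] CsH; first by exists [::].
  have [d dC|B [BN CB]] := IHC; first by apply: CsH; rewrite inE dC orbT.
  have [k Nk] := tH _ (CsH c (mem_head _ _)).
  exists (c * (expz t k)^-1 :: B); split.
    by move=> b; rewrite inE => /orP[/eqP->|/BN].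
  move=> d; rewrite inE => /orP[/eqP->|/CB[b bB dE]].
    by exists (c * (expz t k)^-1); [apply: mem_head|exists k; rewrite mulgVK].
  by exists b => //; rewrite inE bB orbT.
have [L [LB BL]] := conj_lines t B; have [e Ne eN] := cyclic_subgroup t sN.
pose M0 : set G := generated [set x | exists2 b, b \in B & exists k, x = b ^ expz t k].
have sM0 : subgroup M0 by apply: subgroup_generated.
have M0N : M0 `<=` N.
  apply: generated_sub => // x [b /BN Nb [k ->]].
  by apply: nN => //; apply: subzg.
have M0J x k : M0 x -> M0 (x ^ expz t k).
  move: x; apply: (@generated_sub _ _ [set x | M0 (x ^ expz t k)]).
    split=> [|x y /= Mx My]; first by rewrite /= conj1g; apply: (sub1g sM0).
    by rewrite conjMg conjVg; apply: (proj2 sM0).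
  move=> x [b bB [l ->]] /=; rewrite -conjgM -expzD.
  by apply: sub_generated; exists b => //; exists (l + k)%R.
have HM0 h : H h -> exists k, M0 (h * (expz t k)^-1).
  rewrite -CH; move: h.
  apply: (@generated_sub _ _ [set h | exists k, M0 (h * (expz t k)^-1)]).
    exact: subgroup_cyclic_ext.
  move=> c /CB[b bB [k ->]] /=; exists k; rewrite mulgK.
  by apply: sub_generated; exists b => //; exists 0%R; rewrite conjg1.
exists (expz t e :: L); apply/seteqP; split.
  apply: generated_sub => // x /=; rewrite inE => /orP[/eqP->//|/LB[b bB [k ->]]].
  by apply: M0N; apply: sub_generated; exists b => //; exists k.
have sg := @subgroup_generated _ [set` expz t e :: L].
have M0g : M0 `<=` generated [set` expz t e :: L].
  apply: generated_sub => // x [b bB [k ->]]; apply: BL => // y yL.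
  by apply: sub_generated; rewrite /= inE yL orbT.
move=> x Nx; have [k Mk] := HM0 x (NH x Nx).
rewrite -(mulgVK (expz t k) x); apply: (subMg sg); first exact: M0g.
have Ntk : N (expz t k).
  by apply: (subVgE sN); apply: (subMgl sN Nx); apply: M0N.
have [q _ ->] := eN k Ntk; apply: (subzg _ sg); apply: sub_generated.
exact: mem_head.
Qed.

(** The subgroups between [N] and [H] are normal in [H], so the generators of
    [H] can be removed one at a time, each removal being a cyclic step. *)
Lemma fin_gen_abelian_kernel H N : fin_gen H -> subgroup N -> N `<=` H ->
  abelian_mod N H -> fin_gen N.
Proof.
move=> fgH sN; have [l] : exists l : seq G,
    H `<=` generated (N `|` [set` l]) /\ [set` l] `<=` H.
  case: fgH => C <-; exists C; split; last exact: sub_generated.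
  by apply: generated_mono => x; right.
elim: l H fgH => [|t l IHl] H fgH [Hl lH] NH abN.
  suff -> : N = H by [].
  apply/seteqP; split=> // x /Hl; apply: generated_sub => // y [//|].
  by rewrite /= in_nil.
have sH := fin_gen_subgroup fgH.
pose H' := generated (N `|` [set` l]); have sH' : subgroup H' by apply: subgroup_generated.
have NH' : N `<=` H' by move=> x Nx; apply: sub_generated; left.
have H'H : H' `<=` H.
  apply: generated_sub => // x [/NH//|xl]; apply: lH.
  by rewrite /= inE xl orbT.
have Ht : H t by apply: lH; rewrite /= mem_head.
have nH' : normal_in H' H by apply: abelian_mod_normal abN _ _.
have fgH' : fin_gen H'.
  apply: (@fin_gen_cyclic_kernel H H' t) => // h /Hl.
  move: h; apply: (@generated_sub _ _ [set h | exists k, H' (h * (expz t k)^-1)]).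
    apply: subgroup_cyclic_ext => // x k Mx.
    by apply: nH' => //; apply: subzg.
  move=> x [Nx|/=]; first by exists 0%R; rewrite invg1 mulg1; apply: NH'.
  rewrite inE => /orP[/eqP->|xl].
    by exists 1%R; rewrite mulgV; apply: (sub1g sH').
  by exists 0%R; rewrite invg1 mulg1; apply: sub_generated; right.
apply: (IHl H') => //; first by split=> // x xl; apply: sub_generated; right.
by move=> x y /H'H Hx /H'H Hy; apply: abN.
Qed.

(** Subnormal series from [H] down to [N] with finite or abelian factors. *)
Inductive tower (N : set G) : set G -> Prop :=
| tower_nil : tower N N
| tower_cons H M : subgroup M -> M `<=` H -> normal_in M H ->
    finite_index M H \/ abelian_mod M H -> tower N M -> tower N H.

Lemma tower_trans K M H : tower M H -> tower K M -> tower K H.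
Proof.
move=> MH KM; elim: MH KM => // {}H N sN NH nN q _ IH KM.
by apply: (@tower_cons _ H N) => //; apply: IH.
Qed.

Lemma fin_gen_tower H N : tower N H -> fin_gen H -> fin_gen N.
Proof.
elim=> // {}H M sM MH nM [fM|abM] _ IH fgH; apply: IH.
  exact: fin_gen_finite_index fgH.
exact: fin_gen_abelian_kernel abM.
Qed.

End Milnor.

(** * Elementary amenable groups have towers *)
Lemma multiplicative1 (X Y : groupType) (f : {multiplicative X -> Y}) : f 1 = 1.
Proof. by apply: (mulgI (f 1)); rewrite -gmulfM !mulg1. Qed.

Lemma multiplicativeV (X Y : groupType) (f : {multiplicative X -> Y}) x :
  f x^-1 = (f x)^-1.
Proof. by apply: (mulgI (f x)); rewrite -gmulfM !mulgV multiplicative1. Qed.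

Section Towers.
Variable G : groupType.
Hypothesis nfs : no_free_semigroup G.
Implicit Types (H K M N : set G).

(** A subgroup of [X * G].  It matches the section of [G] formed by its image
    modulo its kernel with a quotient of a subgroup of [X].  As relations can be
    composed with morphisms, the closure of the class of elementary amenable
    groups under subgroups and quotients costs nothing, and only subsets of [G]
    are manipulated. *)
Definition relation_subgroup (X : groupType) (R : X -> G -> Prop) :=
  R 1 1 /\ forall x y a b, R x a -> R y b -> R (x * y^-1) (a * b^-1).

Definition relation_image (X : groupType) (R : X -> G -> Prop) : set G :=
  [set a | exists x, R x a].

Definition relation_kernel (X : groupType) (R : X -> G -> Prop) : set G :=
  [set a | R 1 a].

Section RelationTheory.
Variables (X : groupType) (R : X -> G -> Prop).
Hypothesis sR : relation_subgroup R.

Lemma relV x a : R x a -> R x^-1 a^-1.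
Proof.
by move=> xa; rewrite -[x^-1]mul1g -[a^-1]mul1g; apply: (proj2 sR) => //; case: sR.
Qed.

Lemma relM x y a b : R x a -> R y b -> R (x * y) (a * b).
Proof. by move=> xa /relV yb; rewrite -[y]invgK -[b]invgK; apply: (proj2 sR). Qed.

Lemma relJ x y a b : R x a -> R y b -> R (x ^ y) (a ^ b).
Proof. by move=> xa yb; apply: relM; [apply: relV|apply: relM]. Qed.

Lemma subgroup_image : subgroup (relation_image R).
Proof.
split=> [|a b [x xa] [y yb]]; first by exists 1; case: sR.
by exists (x * y^-1); apply: (proj2 sR).
Qed.

Lemma subgroup_kernel : subgroup (relation_kernel R).
Proof.
split=> [|a b /= xa yb]; first by case: sR.
by rewrite /relation_kernel /= -[1](mulgV 1); apply: (proj2 sR).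
Qed.

Lemma kernel_sub_image : relation_kernel R `<=` relation_image R.
Proof. by move=> a; exists 1. Qed.

Lemma kernel_normal : normal_in (relation_kernel R) (relation_image R).
Proof.
by move=> a b Ra [y yb]; rewrite /relation_kernel /= -(conj1g y); apply: relJ.
Qed.

End RelationTheory.

Definition section_tower (X : groupType) := forall R : X -> G -> Prop,
  relation_subgroup R -> fin_gen (relation_image R) ->
  tower (relation_kernel R) (relation_image R).

Lemma section_tower_finite (X : groupType) :
  finite_set [set: X] -> section_tower X.
Proof.
move=> /finite_seqP[s sE] R sR _; apply: tower_cons (tower_nil _).
- exact: subgroup_kernel.
- exact: kernel_sub_image.
- exact: kernel_normal.
left; suff [r rP] : exists r : seq G, forall h x, R x h -> x \in s ->
    exists2 a, a \in r & R x a.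
  exists r => h [x xh]; have xs : x \in s by have : [set: X] x by []; rewrite sE.
  have [a ar xa] := rP h x xh xs.
  exists a => //; split; first by exists x.
  by rewrite /relation_kernel /= -(mulgV x); apply: (proj2 sR).
elim: s {sE} => [|y s [r rP]]; first by exists [::].
case: (pselect (exists a, R y a)) => [[a ya]|ny].
  exists (a :: r) => h x xh; rewrite inE => /orP[/eqP->|/(rP h x xh)[b br xb]].
    by exists a; rewrite ?mem_head.
  by exists b; rewrite ?inE ?br ?orbT.
exists r => h x xh; rewrite inE => /orP[/eqP xy|/(rP h x xh)//].
by case: ny; exists h; rewrite -xy.
Qed.

Lemma section_tower_abelian (X : groupType) :
  (forall x y : X, commute x y) -> section_tower X.
Proof.
move=> XC R sR _; apply: tower_cons (tower_nil _).
- exact: subgroup_kernel.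
- exact: kernel_sub_image.
- exact: kernel_normal.
right=> a b [x xa] [y yb].
have xy : [~ x, y] = 1 by apply/eqP/commgP/XC.
rewrite /relation_kernel /= -xy; apply: relM => //; first exact: relV.
exact: relJ.
Qed.

Lemma section_tower_subgroup (X Y : groupType) (i : {multiplicative Y -> X}) :
  injective i -> section_tower X -> section_tower Y.
Proof.
move=> inji tX R sR; pose R' x a := exists2 y, i y = x & R y a.
have sR' : relation_subgroup R'.
  split=> [|_ _ a b [x <- xa] [y <- yb]].
    by exists 1; [apply: multiplicative1|case: sR].
  exists (x * y^-1); last by apply: (proj2 sR).
  by rewrite gmulfM multiplicativeV.
have <- : relation_image R' = relation_image R.
  by apply/seteqP; split=> [a [_ [y _ ya]]|a [y ya]]; [exists y|exists (i y), y].
have <- : relation_kernel R' = relation_kernel R; last exact: tX.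
apply/seteqP; split=> [a [y yE ya]|a ya]; last first.
  by exists 1 => //; apply: multiplicative1.
suff y1 : y = 1 by rewrite y1 in ya.
by apply: inji; rewrite yE multiplicative1.
Qed.

Lemma relation_subgroup_comp (X Y : groupType) (f : {multiplicative X -> Y})
    (R : Y -> G -> Prop) :
  relation_subgroup R -> relation_subgroup (fun x a => R (f x) a).
Proof.
move=> sR; split=> [|x y a b xa yb]; first by rewrite multiplicative1; case: sR.
by rewrite gmulfM multiplicativeV; apply: (proj2 sR).
Qed.

Lemma relation_kernel_comp (X Y : groupType) (f : {multiplicative X -> Y})
    (R : Y -> G -> Prop) :
  relation_kernel (fun x a => R (f x) a) = relation_kernel R.
Proof. by rewrite /relation_kernel multiplicative1. Qed.

Lemma section_tower_quotient (X Q : groupType) (p : {multiplicative X -> Q}) :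
  range p = [set: Q] -> section_tower X -> section_tower Q.
Proof.
move=> pQ tX R sR; rewrite -(relation_kernel_comp p).
have <- : relation_image (fun x a => R (p x) a) = relation_image R.
  apply/seteqP; split=> [a [x xa]|a [q qa]]; first by exists (p x).
  have : range p q by rewrite pQ.
  by case=> x _ xq; exists x; rewrite xq.
by apply: tX; apply: relation_subgroup_comp.
Qed.

(** [R] restricts to a relation [R1] with [N] and projects to a relation [R2]
    with [Q]; the kernel of [R2] is the image of [R1].  The tower obtained from
    [R2] shows that this common subgroup is finitely generated, as is required
    to use the hypothesis on [N]. *)
Lemma section_tower_extension (N X Q : groupType)
    (i : {multiplicative N -> X}) (p : {multiplicative X -> Q}) :
  injective i -> range p = [set: Q] -> range i = [set g | p g = 1] ->
  section_tower N -> section_tower Q -> section_tower X.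
Proof.
move=> inji pQ iE tN tQ R sR fgR.
pose R1 n a := R (i n) a; pose R2 q a := exists2 x, p x = q & R x a.
have sR1 : relation_subgroup R1 by apply: relation_subgroup_comp.
have sR2 : relation_subgroup R2.
  split=> [|_ _ a b [x <- xa] [y <- yb]].
    by exists 1; [apply: multiplicative1|case: sR].
  exists (x * y^-1); last by apply: (proj2 sR).
  by rewrite gmulfM multiplicativeV.
have im2 : relation_image R2 = relation_image R.
  by apply/seteqP; split=> [a [_ [x _ xa]]|a [x xa]]; [exists x|exists (p x), x].
have ker2 : relation_kernel R2 = relation_image R1.
  apply/seteqP; split=> [a [x /= px xa]|a [n na]].
    have : range i x by rewrite iE.
    by case=> n _ nx; exists n; rewrite /R1 nx.
  exists (i n) => //; have : range i (i n) by exists n.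
  by rewrite iE.
have t2 := tQ R2 sR2; rewrite im2 ker2 in t2.
have := tN R1 sR1 (fin_gen_tower nfs (t2 fgR) fgR).
by rewrite relation_kernel_comp; apply: tower_trans; apply: t2.
Qed.

(** The finitely many generators of the image of [R] are all related to
    elements of a single member of the directed family. *)
Lemma section_tower_union (X : groupType) (I : Type) (H : I -> groupType)
    (f : forall i : I, {multiplicative H i -> X}) :
  (forall i j : I, exists k : I,
     range (f i) `<=` range (f k) /\ range (f j) `<=` range (f k)) ->
  \bigcup_i range (f i) = [set: X] ->
  (forall i : I, section_tower (H i)) -> section_tower X.
Proof.
move=> dir cov tH R sR fgR.
have [C CE] := fgR.
have CR c : c \in C -> relation_image R c.
  by move=> cC; rewrite -CE; apply: sub_generated.
have [i iC] : exists i, forall c, c \in C -> exists y, R (f i y) c.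
  elim: (C) CR => [|c D IHD] CR.
    have : (\bigcup_i range (f i)) 1 by rewrite cov.
    by case=> i _ _; exists i.
  have [d dD|i iD] := IHD; first by apply: CR; rewrite inE dD orbT.
  have [x xc] := CR c (mem_head _ _).
  have : (\bigcup_i range (f i)) x by rewrite cov.
  case=> j _ jx; have [k [ik jk]] := dir i j; exists k => d.
  rewrite inE => /orP[/eqP->|/iD[y yd]].
    by have [y _ yx] := jk x jx; exists y; rewrite yx.
  have /ik[z _ zy] : range (f i) (f i y) by exists y.
  by exists z; rewrite zy.
have sR' := relation_subgroup_comp (f i) sR.
rewrite -(relation_kernel_comp (f i)).
suff imE : relation_image (fun y a => R (f i y) a) = relation_image R.
  by have := tH i _ sR'; rewrite imE; apply.
apply/seteqP; split=> [a [y ya]|]; first by exists (f i y).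
rewrite -CE; apply: generated_sub; first exact: subgroup_image.
by move=> c /iC.
Qed.

Theorem elementary_amenable_section_tower (X : groupType) :
  elementary_amenable X -> section_tower X.
Proof.
elim=> {X} [X|X|X Y i|X Q p|N X Q i p|X I H f].
- exact: section_tower_finite.
- exact: section_tower_abelian.
- by move=> inji _; apply: (section_tower_subgroup inji).
- by move=> pQ _; apply: (section_tower_quotient pQ).
- by move=> inji pQ iE _ tN _ tQ; apply: (section_tower_extension inji pQ iE).
- by move=> _ dir cov _ IH; apply: (section_tower_union dir cov IH).
Qed.

End Towers.

Lemma elementary_amenable_tower (G : groupType) : no_free_semigroup G ->
  fin_gen [set: G] -> elementary_amenable G -> tower [set 1] [set: G].
Proof.
move=> nfs fgG /(elementary_amenable_section_tower nfs) /(_ (fun x a => x = a)).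
have -> : relation_image (fun x a : G => x = a) = [set: G].
  by apply/seteqP; split=> // a _; exists a.
have -> : relation_kernel (fun x a : G => x = a) = [set 1].
  by apply/seteqP; split=> a.
by apply=> //; split=> // x y a b -> ->.
Qed.

(** * From towers to solvable subgroups of finite index *)
Section VirtuallySolvable.
Variable G : groupType.
Implicit Types (H K M N : set G) (x y g h k l : G).

Definition derived H : set G :=
  generated [set z | exists x y, [/\ H x, H y & z = [~ x, y]]].

Lemma derived_abelian H : abelian_mod (derived H) H.
Proof. by move=> x y Hx Hy; apply: sub_generated; exists x, y. Qed.

Lemma derived_sub M H : subgroup M -> abelian_mod M H -> derived H `<=` M.
Proof. by move=> sM abM; apply: generated_sub => // _ [x [y [Hx Hy ->]]]; apply: abM. Qed.

Lemma derived_id H : subgroup H -> derived H `<=` H.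
Proof. by move=> sH; apply: derived_sub => // x y; apply: subRg. Qed.

Lemma derived_mono H K : H `<=` K -> derived H `<=` derived K.
Proof.
by move=> HK; apply: generated_mono => _ [x [y [/HK Hx /HK Hy ->]]]; exists x, y.
Qed.

Lemma derived_conj H g :
  derived [set x | H (x ^ g)] `<=` [set x | derived H (x ^ g)].
Proof.
have sD : subgroup (derived H) by apply: subgroup_generated.
apply: generated_sub => [|_ [x [y [Hx Hy ->]]]].
  split=> [|x y /= Dx Dy]; first by rewrite /= conj1g; apply: (sub1g sD).
  by rewrite conjMg conjVg; apply: (proj2 sD).
by rewrite /= conjRg; apply: derived_abelian.
Qed.

Lemma derived_normal H K : normal_in H K -> normal_in (derived H) K.
Proof.
move=> nH x g Dx Kg; apply: derived_conj; apply: derived_mono x Dx.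
by move=> x Hx; apply: nH.
Qed.

Definition solvable H := exists n, iter n derived H `<=` [set 1].

Lemma iter_derived_mono n H K : H `<=` K ->
  iter n derived H `<=` iter n derived K.
Proof. by move=> HK; elim: n => //= n; apply: derived_mono. Qed.

Lemma solvable_sub H K : H `<=` K -> solvable K -> solvable H.
Proof.
by move=> HK [n Kn]; exists n; apply: subset_trans Kn; apply: iter_derived_mono.
Qed.

Lemma solvable_ext M H : subgroup M -> abelian_mod M H -> solvable M ->
  solvable H.
Proof.
move=> sM abM [n Mn]; exists n.+1; rewrite iterSr; apply: subset_trans Mn.
by apply: iter_derived_mono; apply: derived_sub.
Qed.

Lemma solvable_conj H g : solvable H -> solvable [set x | H (x ^ g)].
Proof.
move=> [n Hn]; exists n.
suff HJ : iter n derived [set x | H (x ^ g)] `<=` [set x | iter n derived H (x ^ g)].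
  by move=> x /HJ /= /Hn /= /eqP; rewrite conjg_eq1 => /eqP.
elim: n {Hn} => //= n IHn; apply: subset_trans (@derived_conj _ g).
exact: derived_mono.
Qed.

Definition setprod H K : set G := [set z | exists x y, [/\ H x, K y & z = x * y]].

Lemma subgroup_setprod H K : subgroup H -> subgroup K -> normal_in K H ->
  subgroup (setprod H K).
Proof.
move=> sH sK nK; split=> [|_ _ [x [y [Hx Ky ->]]] [x' [y' [Hx' Ky' ->]]]].
  by exists 1, 1; split; [apply: sub1g sH|apply: sub1g sK|rewrite mulg1].
exists (x * x'^-1), ((y * y'^-1) ^ x'^-1); split.
- exact: (proj2 sH).
- by apply: nK; [apply: (proj2 sK)|apply: subVg].
- by rewrite conjgE invgK !invgM !mulgA mulgVK.
Qed.

Lemma setprodl H K : subgroup K -> H `<=` setprod H K.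
Proof. by move=> sK x Hx; exists x, 1; rewrite mulg1; split=> //; apply: sub1g. Qed.

Lemma setprodr H K : subgroup H -> K `<=` setprod H K.
Proof. by move=> sH x Hx; exists 1, x; rewrite mul1g; split=> //; apply: sub1g. Qed.

Lemma setprod_sub H K M : subgroup M -> H `<=` M -> K `<=` M -> setprod H K `<=` M.
Proof.
by move=> sM HM KM _ [x [y [/HM Mx /KM My ->]]]; apply: (subMg sM).
Qed.

Lemma setprod_normal H K M : normal_in H M -> normal_in K M ->
  normal_in (setprod H K) M.
Proof.
move=> nH nK _ g [x [y [Hx Ky ->]]] Mg; exists (x ^ g), (y ^ g).
by rewrite conjMg; split=> //; [apply: nH|apply: nK].
Qed.

Lemma solvable_setprod H K : subgroup H -> subgroup K -> normal_in K H ->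
  solvable H -> solvable K -> solvable (setprod H K).
Proof.
move=> sH sK nK [n Hn] solK; elim: n H sH nK Hn => [|n IHn] H sH nK Hn.
  apply: solvable_sub solK => _ [x [y [/Hn /= -> Ky ->]]].
  by rewrite mul1g.
have sD : subgroup (derived H) by apply: subgroup_generated.
have nD : normal_in K (derived H).
  by move=> x g Kx Dg; apply: nK => //; apply: derived_id Dg.
apply: (@solvable_ext (setprod (derived H) K)).
- exact: subgroup_setprod.
- move=> _ _ [x [y [Hx Ky ->]]] [x' [y' [Hx' Ky' ->]]].
  (* [x * y, x' * y'] is congruent to [x, x'] modulo K. *)
  pose d := [~ x, x']; have Dd : derived H d by apply: derived_abelian.
  exists d, (((y' ^ x * y)^-1) ^ d * (y ^ x' * y')); split=> //.
    apply: (subMg sK); last by apply: (subMg sK) => //; apply: nK.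
    by apply: nD => //; apply: (subVg sK); apply: (subMg sK) => //; apply: nK.
  rewrite mulgA -conjgC /d /commg !conjgE !invgM !invgK !mulgA.
  by rewrite !(mulgK, mulgVK).
- by apply: IHn => //; rewrite -iterSr.
Qed.

Lemma solvable1 : solvable [set 1].
Proof. by exists 0%N. Qed.

(** The union of the solvable normal subgroups of [M].  Being canonical, it is
    invariant under conjugation by every group that normalizes [M]. *)
Definition solvable_radical M : set G := [set l | exists K,
  [/\ subgroup K, K `<=` M, normal_in K M, solvable K & K l]].

Section Radical.
Variable M : set G.
Hypothesis sM : subgroup M.
Local Notation rad := (solvable_radical M).

Lemma radical_sub : rad `<=` M.
Proof. by move=> l [K [_ KM _ _ /KM]]. Qed.

Lemma subgroup_radical : subgroup rad.
Proof.
split=> [|x y [K [sK KM nK solK Kx]] [L [sL LM nL solL Ly]]].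
  exists [set 1]; split=> //.
  - exact: subgroup1.
  - by move=> _ ->; apply: (sub1g sM).
  - by move=> _ g -> _; rewrite /= conj1g.
  - exact: solvable1.
have nLK : normal_in L K by move=> a g La /KM; apply: nL.
exists (setprod K L); split.
- exact: subgroup_setprod.
- exact: setprod_sub.
- exact: setprod_normal.
- exact: solvable_setprod.
- by exists x, y^-1; split=> //; apply: subVg.
Qed.

Lemma radical_normal H : subgroup H -> normal_in M H -> normal_in rad H.
Proof.
move=> sH nM l g [K [sK KM nK solK Kl]] Hg; have Hg' := subVg sH Hg.
exists [set x | K (x ^ g^-1)]; split.
- split=> [|x y /= Kx Ky]; first by rewrite /= conj1g; apply: (sub1g sK).
  by rewrite conjMg conjVg; apply: (proj2 sK).
- by move=> x /= /KM Mx; rewrite -(conjgKV g x); apply: nM.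
- by move=> x m /= Kx Mm; rewrite conjJg; apply: nK => //; apply: nM.
- exact: solvable_conj.
- by rewrite /= conjgK.
Qed.

(** When [M] has a solvable normal subgroup [K] of finite index, the radical
    is covered by finitely many cosets of [K], hence by the product of [K] with
    finitely many solvable normal subgroups. *)
Lemma radical_solvable K : subgroup K -> K `<=` M -> normal_in K M ->
  finite_index K M -> solvable K -> solvable rad /\ finite_index rad M.
Proof.
move=> sK KM nK [s sP] solK.
have Krad : K `<=` rad by move=> x Kx; exists K.
split; last first.
  exists s => h Mh; have [r rs [Mr Kr]] := sP h Mh; exists r => //; split=> //.
  exact: Krad.
have [L [[sL LM nL solL KL] sLr]] : exists L, [/\ subgroup L, L `<=` M,
    normal_in L M, solvable L & K `<=` L] /\ forall r, r \in s -> rad r -> L r.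
  elim: (s) => [|r t [L [[sL LM nL solL KL] tL]]].
    by exists K; split; [split|].
  case: (pselect (rad r)) => [|nr]; last first.
    exists L; split=> // q; rewrite inE => /orP[/eqP-> /nr []|/tL]; apply.
  move=> [L' [sL' LM' nL' solL' Lr]].
  have nL'L : normal_in L' L by move=> a g La /LM; apply: nL'.
  exists (setprod L L'); split; first split.
  - exact: subgroup_setprod.
  - exact: setprod_sub.
  - exact: setprod_normal.
  - exact: solvable_setprod.
  - by apply: subset_trans KL _; apply: setprodl.
  move=> q; rewrite inE => /orP[/eqP-> _|/tL qL /qL]; first exact: setprodr.
  exact: setprodl.
apply: solvable_sub solL => l radl.
have [r rs [Mr Kr]] := sP l (radical_sub radl).
rewrite -(mulgVK r l); apply: (subMg sL); first exact: KL.
apply: sLr => //; have sR := subgroup_radical.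
by apply: (subVgE sR); apply: (subMgl sR radl); apply: Krad.
Qed.

End Radical.

Definition virtually_solvable H := exists K,
  [/\ subgroup K, K `<=` H, normal_in K H, finite_index K H & solvable K].

Lemma virtually_solvable_finite M H : subgroup H -> subgroup M -> M `<=` H ->
  normal_in M H -> finite_index M H -> virtually_solvable M -> virtually_solvable H.
Proof.
move=> sH sM MH nM fM [K [sK KM nK fK solK]].
have [solR fR] := radical_solvable sM sK KM nK fK solK.
exists (solvable_radical M); split=> //.
- exact: subgroup_radical.
- by apply: subset_trans MH; apply: radical_sub.
- exact: radical_normal.
- apply: (@finite_index_trans _ _ M) => //; first exact: subgroup_radical.
  exact: radical_sub.
Qed.

(** [H] permutes the finite set of cosets of [R] in [M], and elements that
    induce the same permutation differ by an element of the kernel. *)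
Lemma finite_index_centralizer R M H : subgroup H -> subgroup R -> R `<=` M ->
  normal_in M H -> M `<=` H -> normal_in R H -> finite_index R M ->
  finite_index [set h | H h /\ forall l, M l -> R (l^-1 * l ^ h)] H.
Proof.
move=> sH sR RM nM MH nR [s sP].
(* [f h] records, for each representative, the one of its image under h. *)
pose found h i r : bool := `[< R (s`_i ^ h * r^-1) >].
pose f h := [ffun i : 'I_(size s) => inord (find (found h i) s) : 'I_(size s).+1].
apply: (finite_index_fun (f := f)) => h k Hh Hk fhk; split; first exact: (proj2 sH).
move=> l Ml; have [r rs [Mr Rlr]] := sP l Ml.
have [i isz rE] : exists2 i, (i < size s)%N & r = s`_i.
  by exists (index r s); rewrite ?index_mem ?nth_index.
have foundP g : H g -> R (s`_i ^ g * (s`_(find (found g i) s))^-1).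
  move=> Hg; have hasg : has (found g i) s.
    have Mg : M (s`_i ^ g) by apply: nM => //; rewrite -rE.
    by have [q qs [_ Rq]] := sP _ Mg; apply/hasP; exists q => //; apply/asboolP.
  by have /asboolP := nth_find 1 hasg.
have fE : find (found h i) s = find (found k i) s.
  have := congr1 (fun F : {ffun 'I_(size s) -> 'I_(size s).+1} =>
    (F (Ordinal isz) : nat)) fhk.
  by rewrite /f !ffunE /= !inordK // ltnS find_size.
have Rhk : R (r ^ h * (r ^ k)^-1).
  have Rh := foundP h Hh; have Rk := foundP k Hk; rewrite fE in Rh.
  by rewrite rE; have := proj2 sR _ _ Rh Rk; rewrite invgM invgK mulgA mulgVK.
pose c := l * r^-1; have lE : l = c * r by rewrite /c mulgVK.
have Hk' := subVg sH Hk.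
have -> : l^-1 * l ^ (h * k^-1) =
  (((c ^ k)^-1 * c ^ h * (r ^ h * (r ^ k)^-1)) ^ (r ^ k)) ^ k^-1.
  have cE A B P Q : (A^-1 * B * (P * Q^-1)) ^ Q = (A * Q)^-1 * (B * P) :> G.
    by rewrite conjgE invgM !mulgA mulgVK.
  by rewrite cE -!conjMg -lE conjMg conjVg conjgK conjgM.
apply: (nR) => //; apply: (nR); last by apply: MH; apply: nM.
apply: (subMg sR) => //; apply: (subMg sR); first by apply: (subVg sR); apply: nR.
exact: nR.
Qed.

(** Let [Z] be the centralizer in [H] of [M] modulo its radical [R].  It has
    finite index since [M / R] is finite, and it is solvable: [Z / (Z :&: M)] is
    abelian as [H / M] is, and [(Z :&: M) / R] is abelian by definition of
    [Z]. *)
Lemma virtually_solvable_abelian M H : subgroup H -> subgroup M -> M `<=` H ->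
  normal_in M H -> abelian_mod M H -> virtually_solvable M ->
  virtually_solvable H.
Proof.
move=> sH sM MH nM abM [K [sK KM nK fK solK]].
have [solR fR] := radical_solvable sM sK KM nK fK solK.
set R := solvable_radical M in solR fR.
have sR : subgroup R by apply: subgroup_radical.
have nR : normal_in R H by apply: radical_normal.
have RM : R `<=` M by apply: radical_sub.
pose Z : set G := [set h | H h /\ forall l, M l -> R (l^-1 * l ^ h)].
have sZ : subgroup Z.
  split=> [|h k [Hh Zh] [Hk Zk]].
    split; first exact: (sub1g sH).
    by move=> l _; rewrite conjg1 mulVg; apply: (sub1g sR).
  have Hk' := subVg sH Hk; split=> [|l Ml]; first exact: (subMg sH).
  have -> : l^-1 * l ^ (h * k^-1) = ((l^-1 * l ^ k)^-1 * (l^-1 * l ^ h)) ^ k^-1.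
    by rewrite invgM invgK -mulgA mulVKg conjMg conjVg conjgK conjgM.
  by apply: nR => //; apply: (subMg sR); [apply: (subVg sR); apply: Zk|apply: Zh].
have ZH : Z `<=` H by move=> h [].
exists Z; split=> //.
- move=> h g [Hh Zh] Hg; split=> [|l Ml]; first exact: (subJg sH).
  have Hg' := subVg sH Hg.
  rewrite -[l](conjgKV g) -conjJg -conjVg -conjMg; apply: nR => //.
  by apply: Zh; apply: nM.
- exact: finite_index_centralizer.
apply: (@solvable_ext (Z `&` M)); first exact: subgroupI.
  by move=> x y Zx Zy; split; [apply: (subRg sZ)|apply: abM; apply: ZH].
apply: (@solvable_ext R) => // x y [Zx Mx] [[_ Zy] My].
exact: Zy.
Qed.

Lemma tower_virtually_solvable H : subgroup H -> tower [set 1] H ->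
  virtually_solvable H.
Proof.
move=> sH t; elim: t sH => [sH|{}H M sM MH nM q _ IH sH].
  exists [set 1]; split=> //.
  - by move=> _ g -> _; rewrite /= conj1g.
  - by exists [:: 1] => h ->; exists 1; rewrite ?mem_head // mulgV.
  - exact: solvable1.
case: q => [fM|abM].
  exact: virtually_solvable_finite (IH sM).
exact: virtually_solvable_abelian (IH sM).
Qed.

End VirtuallySolvable.

(** * Sequences of polynomially bounded word length *)
Section PolynomialLength.
Variable G : groupType.
Implicit Types (H K M N : set G) (x y g h c : G) (C : seq G) (u v w m : nat -> G).

Definition poly_short C u := exists D, forall i, ball C (i.+2 ^ D) (u i).

Lemma leq_exp2S n i : n <= i.+2 ^ n.
Proof. by apply: (leq_trans (ltnW (ltn_expl n (isT : 1 < 2)))); apply: leq_expl. Qed.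

Lemma poly_short_const C x : generated [set` C] x -> poly_short C (fun=> x).
Proof.
by move=> /generated_ball[n xn]; exists n => i; apply: ball_le xn; apply: leq_exp2S.
Qed.

Lemma poly_shortM C u v : poly_short C u -> poly_short C v ->
  poly_short C (fun i => u i * v i).
Proof.
move=> [D uD] [E vE]; exists (D + E).+1 => i.
by apply: (ball_le _ (ballM (uD i) (vE i))); apply: leq_expD.
Qed.

Lemma poly_shortV C u : poly_short C u -> poly_short C (fun i => (u i)^-1).
Proof. by move=> [D uD]; exists D => i; apply: ballV. Qed.

Lemma poly_short_trans C C' u : [set` C] `<=` generated [set` C'] ->
  poly_short C u -> poly_short C' u.
Proof.
move=> /ball_uniform[k kC] [D uD]; exists (D + k)%N => i.
by apply: (ball_le _ (ball_trans kC (uD i))); rewrite leq_expM // leq_exp2S.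
Qed.

Lemma poly_short_expz C x (r : nat -> int) E : generated [set` C] x ->
  (forall i, (`|r i| <= i.+2 ^ E)%N) -> poly_short C (fun i => expz x (r i)).
Proof.
move=> /generated_ball[n xn] rE; exists (E + n)%N => i.
by apply: (ball_le _ (ball_expz (r i) xn)); rewrite leq_expM ?leq_exp2S.
Qed.

Lemma poly_short_prod C (y : nat -> G) (r : nat -> nat -> int) E n :
  (forall k, generated [set` C] (y k)) -> (forall i k, (`|r i k| <= i.+2 ^ E)%N) ->
  poly_short C (fun i => \prod_(k < n) expz (y k) (r i k)).
Proof.
move=> yC rE; elim: n => [|n [D nD]].
  by exists 0%N => i; rewrite big_ord0; apply: ball1.
have [F nF] := poly_short_expz (yC n) (rE ^~ n).
exists (D + F).+1 => i; rewrite big_ord_recr.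
by apply: (ball_le _ (ballM (nD i) (nF i))); apply: leq_expD.
Qed.

Lemma ball_conj C k n x h : (forall c, c \in C -> ball C k (c ^ h)) ->
  ball C n x -> ball C (n * k) (x ^ h).
Proof.
move=> Ck; elim: n x => [|n IHn] x; first by move=> ->; rewrite conj1g; apply: ball1.
case=> y /IHn yn [c cC ->]; rewrite mulSn addnC conjMg; apply: ballM => //.
move: cC; rewrite !inE !mem_cat => /or3P[/eqP->|/Ck//|/mapP[d /Ck dC ->]].
  by rewrite conj1g; apply: ball1.
by rewrite conjVg; apply: ballV.
Qed.

(** Conjugation by the powers of [g] lengthens words in [C] only
    polynomially. *)
Definition poly_conj C g := forall c, c \in C -> poly_short C (fun i => c ^ (g ^+ i)).

Lemma poly_conj_ball C g : poly_conj C g -> exists D, forall i n x,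
  ball C n x -> ball C (n * i.+2 ^ D) (x ^ (g ^+ i)).
Proof.
move=> sC; suff [D cD] : exists D, forall c, c \in C ->
    forall i, ball C (i.+2 ^ D) (c ^ (g ^+ i)).
  by exists D => i n x; apply: ball_conj => c cC; apply: cD.
suff: forall l : seq G, {subset l <= C} -> exists D, forall c, c \in l ->
  forall i, ball C (i.+2 ^ D) (c ^ (g ^+ i)) by move/(_ C); apply.
elim=> [|c l IHl] lC; first by exists 0%N.
have [d dl|D cD] := IHl; first by apply: lC; rewrite inE dl orbT.
have [E cE] := sC c (lC c (mem_head _ _)); exists (maxn D E) => d.
rewrite inE => /orP[/eqP->|/cD dD] i.
  by apply: ball_le (cE i); rewrite leq_pexp2l ?leq_maxr.
by apply: ball_le (dD i); rewrite leq_pexp2l ?leq_maxl.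
Qed.

(** Unfolding the recurrence, [m n] is the product of the conjugates of
    [v (n - 1 - j)] by [g ^+ j] and of the conjugate of [m 0] by [g ^+ n]. *)
Lemma poly_short_recurrence C g v m : poly_conj C g -> poly_short C v ->
  generated [set` C] (m 0%N) ->
  (forall i, m i.+1 = v i * m i ^ g) -> poly_short C m.
Proof.
move=> /poly_conj_ball[D gD] [E vE] /generated_ball[k0 m0] mS.
have mb n k j : k + j <= n ->
    ball C ((k0 + k * n.+2 ^ E) * n.+2 ^ D) (m k ^ (g ^+ j)).
  elim: k j => [|k IHk] j kj.
    rewrite mul0n addn0; apply: ball_le (gD j _ _ m0).
    by rewrite leq_mul // leq_expl //; lia.
  have -> : ((k0 + k.+1 * n.+2 ^ E) * n.+2 ^ D)%N =
      (n.+2 ^ E * n.+2 ^ D + (k0 + k * n.+2 ^ E) * n.+2 ^ D)%N.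
    by rewrite -mulnDl mulSn addnCA.
  rewrite mS conjMg -conjgM -expgS; apply: ballM; last by apply: IHk; lia.
  apply: ball_le (gD j _ _ (vE k)).
  by rewrite leq_mul // leq_expl //; lia.
exists ((k0 + (1 + E)).+1 + D)%N => n.
have := mb n n 0%N; rewrite addn0 conjg1 => /(_ (leqnn n)); apply: ball_le.
rewrite leq_expM // leq_expD ?leq_exp2S // leq_expM //.
by rewrite expn1; lia.
Qed.

Definition poly_distorted C C' := exists D, forall n y,
  ball C' n y -> generated [set` C] y -> ball C (n.+2 ^ D) y.

Definition poly_growth C := exists D, forall n, exists2 s : seq G,
  size s <= n.+2 ^ D & forall x, ball C n x -> x \in s.

Lemma leq_comp n D : (n.+2 ^ D).+2 <= n.+2 ^ (D + 1).+1.
Proof. by rewrite -addn2 leq_expD // expn1. Qed.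

Lemma poly_distorted_trans C C' C'' : [set` C] `<=` generated [set` C'] ->
  poly_distorted C C' -> poly_distorted C' C'' -> poly_distorted C C''.
Proof.
move=> CC' [D dD] [E dE]; exists ((E + 1).+1 * D)%N => n y yn yC.
have yC' : generated [set` C'] y by apply: generated_sub yC; first exact: subgroup_generated.
apply: ball_le (dD _ _ (dE n y yn yC') yC).
by rewrite expnM leq_expl // leq_comp.
Qed.

(** Moving the letters [x] of a word of length [n] to the right end conjugates
    the other letters by powers of [x] with exponent at most [n]. *)
Lemma cyclic_ball C x : poly_conj C x -> poly_conj C x^-1 -> exists D, forall n y,
  ball (x :: C) n y -> exists2 k : int, (`|k| <= n)%N &
    ball C (n.+2 ^ D) (y * (expz x k)^-1).
Proof.
move=> /poly_conj_ball[D xD] /poly_conj_ball[E xE]; pose F := (D + E)%N.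
have cF c k : c \in letters C -> ball C (`|k|.+2 ^ F) (c ^ expz x k).
  move=> /ball_letter c1; case: k => k.
    by apply: ball_le (xD k _ _ c1); rewrite mul1n leq_pexp2l ?leq_addr.
  rewrite /= -expVgn; apply: ball_le (xE k.+1 _ _ c1).
  by rewrite mul1n leq_pexp2l ?leq_addl.
exists (1 + F)%N => n y yn.
suff step i z : i <= n -> ball (x :: C) i z -> exists2 k : int,
    (`|k| <= i)%N & ball C (i * n.+2 ^ F) (z * (expz x k)^-1).
  have [k kn yk] := step n y (leqnn n) yn; exists k => //.
  by apply: ball_le yk; rewrite leq_expM // expn1; lia.
elim: i z => [|i IHi] y' im.
  by move=> ->; exists 0%R => //; rewrite mulgV; apply: ball1.
case=> z zn [c cC ->]; have [k kn zk] := IHi z (ltnW im) zn.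
have [[e e1 ->]|{}cC] : (exists2 e : int, (`|e| <= 1)%N & c = expz x e) \/
    c \in letters C.
  move: cC; rewrite !inE => /or3P[/eqP->|/eqP->|].
  - by left; exists 0%R.
  - by left; exists 1%R => //=; rewrite expg1.
  rewrite !mem_cat /= inE => /or3P[cC|/eqP->|cC].
  - by right; rewrite cC orbT.
  - by left; exists (-1)%R => //=; rewrite expg1.
  - by right; rewrite cC !orbT.
- exists (k + e)%R; first by lia.
  rewrite expzD invgM mulgA mulgK; apply: ball_le zk.
  by rewrite leq_mul2r leqnSn orbT.
exists k; first exact: leqW.
have -> : z * c * (expz x k)^-1 = z * (expz x k)^-1 * c ^ expz x (- k)%R.
  by rewrite conjgE expzN invgK !mulgA mulgVK.
rewrite mulSn addnC; apply: ballM => //; apply: ball_le (cF c (- k)%R cC).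
by rewrite leq_expl // !ltnS; lia.
Qed.

Lemma cyclic_poly_distorted C x : poly_conj C x -> poly_conj C x^-1 ->
  poly_distorted C (x :: C).
Proof.
have sC := @subgroup_generated _ [set` C].
move=> sx sx'; have [D xD] := cyclic_ball sx sx'.
have [e Ce eC] := cyclic_subgroup x sC; have [k ke] := generated_ball Ce.
exists (D + (1 + k)).+1 => n y yn Cy; have [a an ya] := xD n y yn.
rewrite -(mulgVK (expz x a) y).
have Ca : generated [set` C] (expz x a).
  by apply: (subVgE sC); apply: (subMgl sC Cy); apply: ball_generated ya.
have [q qa aE] := eC a Ca.
have xa : ball C (n * k) (expz x a).
  rewrite aE; apply: ball_le (ball_expz q ke).
  by rewrite leq_mul2r (leq_trans qa an) orbT.
apply: (ball_le _ (ballM ya xa)); rewrite leq_expD // leq_expM ?leq_exp2S //.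
by rewrite expn1; lia.
Qed.

Lemma cyclic_poly_growth C x : poly_conj C x -> poly_conj C x^-1 -> poly_growth C ->
  poly_growth (x :: C).
Proof.
move=> sx sx' [E EC]; have [D xD] := cyclic_ball sx sx'.
exists ((D + 1).+1 * E + 2)%N => n; have [s ss sC] := EC (n.+2 ^ D)%N.
exists [seq y * z | y <- s, z <- [seq x ^+ k | k <- iota 0 (n + 1)] ++
  [seq x ^- k | k <- iota 0 (n + 1)]].
  rewrite size_allpairs size_cat !size_map !size_iota.
  apply: leq_expM; last by rewrite expnS expn1; nia.
  by apply: (leq_trans ss); rewrite expnM leq_expl // leq_comp.
move=> y /xD[k kn /sC ys]; apply/allpairsP; exists (y * (expz x k)^-1, expz x k).
rewrite /= mulgVK; split=> //; rewrite mem_cat; case: k kn {ys} => k kn /=.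
  by apply/orP; left; apply: map_f; rewrite mem_iota; lia.
apply/orP; right; apply: (map_f (fun k => x ^- k)).
by rewrite mem_iota; lia.
Qed.

(** The commutators [[x, g ^+ n]] satisfy the recurrence of
    [poly_short_recurrence] with the constant sequence [[x, g]]. *)
Lemma poly_conj_extend C l g : poly_conj C g ->
  (forall x, x \in l -> generated [set` C] [~ x, g]) -> poly_conj (l ++ C) g.
Proof.
move=> sC lC c; have CCl : [set` C] `<=` generated [set` l ++ C].
  by move=> x xC; apply: sub_generated; rewrite /= mem_cat xC orbT.
rewrite mem_cat => /orP[cl|/sC]; last exact: poly_short_trans.
pose m i := c^-1 * c ^ (g ^+ i).
have mC : poly_short C m.
  apply: (poly_short_recurrence (g := g) (v := fun=> [~ c, g])) => //.
  - by apply: poly_short_const; apply: lC.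
  - by rewrite /m conjg1 mulVg; apply: (sub1g (@subgroup_generated _ _)).
  - move=> i; rewrite /m (conjMg c^-1) commgEl conjVg -(mulgA c^-1) mulVKg.
    by rewrite expgSr conjgM.
have -> : (fun i => c ^ (g ^+ i)) = (fun i => c * m i).
  by apply/funext => i; rewrite /m mulVKg.
apply: poly_shortM; last exact: poly_short_trans mC.
by apply: poly_short_const; apply: sub_generated; rewrite /= mem_cat cl.
Qed.

(** The elements of [l] are adjoined one at a time.  As they commute modulo
    the group generated by [C], conjugation by one of them still lengthens words
    polynomially after the others have been adjoined
    ([poly_conj_extend]). *)
Lemma abelian_poly_step C l :
  (forall x y, x \in l -> y \in l -> generated [set` C] [~ x, y]) ->
  (forall x, x \in l -> poly_conj C x /\ poly_conj C x^-1) ->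
  poly_distorted C (l ++ C) /\ (poly_growth C -> poly_growth (l ++ C)).
Proof.
have sC := @subgroup_generated _ [set` C].
elim: l => [|x l IHl] abl sl.
  by split=> //; exists 1%N => n y yn _; rewrite expn1; apply: ball_le yn; lia.
have abl' y z : y \in l -> z \in l -> generated [set` C] [~ y, z].
  by move=> yl zl; apply: abl; rewrite inE ?yl ?zl orbT.
have sl' y : y \in l -> poly_conj C y /\ poly_conj C y^-1.
  by move=> yl; apply: sl; rewrite inE yl orbT.
have [dl gl] := IHl abl' sl'.
have [sx sx'] := sl x (mem_head _ _).
have Cx y : y \in l -> generated [set` C] [~ y, x].
  by move=> yl; apply: abl; rewrite ?mem_head // inE yl orbT.
have slx : poly_conj (l ++ C) x by apply: poly_conj_extend.
have slx' : poly_conj (l ++ C) x^-1.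
  apply: poly_conj_extend => // y yl; have yx := Cx y yl.
  have -> : [~ y, x^-1] = [~ y, x]^-1 ^ x^-1.
    by rewrite (commgEl y x) invgM invgK (conjMg _ y) conjVg conjgK.
  have [k yk] := generated_ball (subVg sC yx).
  have [D /(_ 1%N _ _ yk)] := poly_conj_ball sx'.
  by rewrite expg1 => /ball_generated.
split=> [|/gl]; last exact: cyclic_poly_growth.
apply: (poly_distorted_trans _ dl); last exact: cyclic_poly_distorted.
by move=> y yC; apply: sub_generated; rewrite /= mem_cat yC orbT.
Qed.

End PolynomialLength.

(** * Abelian sections as additive groups *)
Record abelian_section (G : groupType) := AbelianSection {
  sec_num : set G;
  sec_den : set G;
  sec_num_subgroup : subgroup sec_num;
  sec_den_subgroup : subgroup sec_den;
  sec_den_sub : sec_den `<=` sec_num;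
  sec_abelian : abelian_mod sec_den sec_num }.

Section SectionQuotient.
Variables (G : groupType) (S : abelian_section G).
Local Notation N := (sec_num S).
Local Notation M := (sec_den S).
Let sN : subgroup N := sec_num_subgroup S.
Let sM : subgroup M := sec_den_subgroup S.
Implicit Types (x y z g : G).

Definition lcoset x : set G := [set y | M (x^-1 * y)].

(** The elements of the quotient are the left cosets themselves, so equality is
    equality of sets; the operations go through chosen representatives. *)
Definition section_quotient :=
  {A : set G | `[< exists2 x, N x & A = lcoset x >]}.

HB.instance Definition _ := Choice.on section_quotient.

Definition sec_repr (a : section_quotient) : G := s2val (cid2 (asboolW (valP a))).

Lemma sec_repr_num a : N (sec_repr a).
Proof. by rewrite /sec_repr; case: cid2. Qed.

Lemma sec_proj_subproof x :
  `[< exists2 y, N y & (if pselect (N x) then lcoset x else lcoset 1) = lcoset y >].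
Proof.
apply/asboolP; case: pselect => Nx; first by exists x.
by exists 1 => //; apply: (sub1g sN).
Qed.

(** Outside [N] the value is the coset of the neutral element. *)
Definition sec_proj x : section_quotient :=
  exist _ (if pselect (N x) then lcoset x else lcoset 1) (sec_proj_subproof x).

Lemma lcoset_eq x y : N x -> N y -> lcoset x = lcoset y <-> M (x^-1 * y).
Proof.
move=> Nx Ny; split=> [xy|xy].
  have : lcoset y y by rewrite /lcoset /= mulVg; apply: (sub1g sM).
  by rewrite -xy.
apply/seteqP; split=> z; rewrite /lcoset /= => Mz.
  by apply: (subMgl sM xy); rewrite -mulgA mulVKg.
by have := subMg sM xy Mz; rewrite -mulgA mulVKg.
Qed.

Lemma sec_proj_val x : N x -> val (sec_proj x) = lcoset x.
Proof. by move=> Nx /=; case: pselect. Qed.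

Lemma sec_proj_eq x y : N x -> N y -> sec_proj x = sec_proj y <-> M (x^-1 * y).
Proof.
move=> Nx Ny; rewrite -lcoset_eq // -!sec_proj_val //.
by split=> [->//|]; apply: val_inj.
Qed.

Lemma sec_reprK a : sec_proj (sec_repr a) = a.
Proof.
apply: val_inj; rewrite sec_proj_val; last exact: sec_repr_num.
by rewrite /sec_repr; case: (cid2 _).
Qed.

Lemma sec_projK x : N x -> M (x^-1 * sec_repr (sec_proj x)).
Proof.
move=> Nx; apply/sec_proj_eq; rewrite ?sec_reprK //; exact: sec_repr_num.
Qed.

Definition sec_add a b := sec_proj (sec_repr a * sec_repr b).
Definition sec_opp a := sec_proj (sec_repr a)^-1.

Lemma sec_normal x y : M x -> N y -> M (x ^ y).
Proof.
apply: (abelian_mod_normal sM (@sec_abelian _ S)) => //; exact: sec_den_sub.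
Qed.

Lemma sec_projM x y : N x -> N y ->
  sec_proj (x * y) = sec_add (sec_proj x) (sec_proj y).
Proof.
move=> Nx Ny; have Nx' := sec_repr_num (sec_proj x).
have Ny' := sec_repr_num (sec_proj y).
apply/sec_proj_eq; [exact: subMg|exact: subMg|].
have -> : (x * y)^-1 * (sec_repr (sec_proj x) * sec_repr (sec_proj y)) =
   (x^-1 * sec_repr (sec_proj x)) ^ y * (y^-1 * sec_repr (sec_proj y)).
  by rewrite conjgE invgM !mulgA mulgK.
by apply: (subMg sM); [apply: sec_normal => //|]; apply: sec_projK.
Qed.

Lemma sec_projV x : N x -> sec_proj x^-1 = sec_opp (sec_proj x).
Proof.
move=> Nx; have Nx' := sec_repr_num (sec_proj x).
apply/sec_proj_eq; [exact: subVg|exact: subVg|].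
rewrite invgK; have := sec_normal (subVg sM (sec_projK Nx)) (subVg sN Nx).
by rewrite conjgE !invgM !invgK !mulgA mulgK.
Qed.

Lemma sec_addA : associative sec_add.
Proof.
move=> a b c; rewrite -[a]sec_reprK -[b]sec_reprK -[c]sec_reprK.
by rewrite -!sec_projM ?mulgA //; do ?apply: (subMg sN); apply: sec_repr_num.
Qed.

Lemma sec_addC : commutative sec_add.
Proof.
move=> a b; have Na := sec_repr_num a; have Nb := sec_repr_num b.
apply/sec_proj_eq; [exact: subMg|exact: subMg|].
have := sec_abelian Nb Na; congr M.
by rewrite commgEl conjgE invgM !mulgA.
Qed.

Lemma sec_add0 : left_id (sec_proj 1) sec_add.
Proof.
move=> a; rewrite -[a in LHS]sec_reprK -sec_projM ?mul1g ?sec_reprK //.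
  exact: (sub1g sN).
exact: sec_repr_num.
Qed.

Lemma sec_addN : left_inverse (sec_proj 1) sec_opp sec_add.
Proof.
move=> a; have Na := sec_repr_num a.
rewrite -[a]sec_reprK -sec_projV // -sec_projM ?mulVg //.
exact: (subVg sN).
Qed.

HB.instance Definition _ :=
  GRing.isZmodule.Build section_quotient sec_addA sec_addC sec_add0 sec_addN.

Local Open Scope ring_scope.

Lemma sec_proj1 : sec_proj 1%g = 0. Proof. by []. Qed.

Lemma sec_projD x y : N x -> N y -> sec_proj (x * y)%g = sec_proj x + sec_proj y.
Proof. exact: sec_projM. Qed.

Lemma sec_projN x : N x -> sec_proj x^-1%g = - sec_proj x.
Proof. exact: sec_projV. Qed.

Lemma sec_projX x k : N x -> sec_proj (expz x k) = sec_proj x *~ k.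
Proof.
move=> Nx; have XE n : sec_proj (x ^+ n)%g = sec_proj x *+ n.
  elim: n => [|n IHn]; first by rewrite expg0 mulr0n.
  by rewrite expgS sec_projD ?IHn ?mulrS //; apply: (subXg sN).
case: k => n; first exact: XE.
by rewrite NegzE mulrNz /= sec_projN ?XE //; apply: (subXg sN).
Qed.

Lemma sec_proj_prod n (y : nat -> G) (r : nat -> int) : (forall k, N (y k)) ->
  N (\prod_(k < n) expz (y k) (r k))%g /\
  sec_proj (\prod_(k < n) expz (y k) (r k))%g = \sum_(k < n) sec_proj (y k) *~ r k.
Proof.
move=> Ny; elim: n => [|n [Nn nE]].
  by rewrite !big_ord0; split=> //; apply: (sub1g sN).
have Nyn : N (expz (y n) (r n)) by apply: subzg.
rewrite !big_ord_recr /=; split; first exact: (subMg sN).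
by rewrite sec_projD // nE sec_projX.
Qed.

Lemma sec_proj_gen C : generated [set` C] = N -> forall a : section_quotient,
  exists z : nat -> int, a = \sum_(i < size [seq sec_proj c | c <- C])
    [seq sec_proj c | c <- C]`_i *~ z i.
Proof.
move=> CN a; rewrite -[a]sec_reprK; have := sec_repr_num a.
move: (sec_repr a) => x {a} Nx; have := Nx; rewrite -{1}CN.
set X := map _ _ => Cx.
suff [_] : N x /\ exists z : nat -> int, sec_proj x = \sum_(i < size X) X`_i *~ z i by [].
move: x {Nx} Cx; apply: (@generated_sub _ _ [set x | N x /\
   exists z : nat -> int, sec_proj x = \sum_(i < size X) X`_i *~ z i]).
  split=> [|x y /= [Nx [z xE]] [Ny [t yE]]].
    split; first exact: (sub1g sN).
    by exists (fun=> 0); rewrite big1 // => i _; rewrite mulr0z.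
  split; first exact: (proj2 sN).
  exists (fun i => z i - t i); rewrite sec_projD ?sec_projN //; last exact: (subVg sN).
  by rewrite xE yE -sumrB; apply: eq_bigr => i _; rewrite mulrzBr.
move=> c cC; split; first by rewrite -CN; apply: sub_generated.
have cX : (index (sec_proj c) X < size X)%N by rewrite index_mem map_f.
exists (fun i => (i == index (sec_proj c) X)%:Z).
rewrite (bigD1 (Ordinal cX)) //= eqxx mulr1z nth_index ?map_f // big1 ?addr0 //.
by move=> i; rewrite -val_eqE /= => /negPf->; rewrite mulr0z.
Qed.

Section SectionConjugation.
Variable g : G.
Hypotheses (gN : forall x, N x -> N (x ^ g)%g) (gM : forall x, M x -> M (x ^ g)%g).

Definition sec_conj (a : section_quotient) : section_quotient :=
  sec_proj (sec_repr a ^ g)%g.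

Lemma sec_conj_proj x : N x -> sec_conj (sec_proj x) = sec_proj (x ^ g)%g.
Proof.
move=> Nx; have Nx' := sec_repr_num (sec_proj x).
apply/esym/sec_proj_eq; [exact: gN|exact: gN|].
by rewrite -conjVg -conjMg; apply/gM/sec_projK.
Qed.

Lemma sec_conjD a b : sec_conj (a + b) = sec_conj a + sec_conj b.
Proof.
have Na := sec_repr_num a; have Nb := sec_repr_num b.
rewrite -[a]sec_reprK -[b]sec_reprK -sec_projD // !sec_conj_proj //; last exact: subMg.
by rewrite conjMg sec_projD //; apply: gN.
Qed.

Lemma sec_conj_iter n x : N x ->
  N (x ^ (g ^+ n))%g /\ iter n sec_conj (sec_proj x) = sec_proj (x ^ (g ^+ n))%g.
Proof.
move=> Nx; elim: n => [|n [Nn nE]]; first by rewrite conjg1.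
by rewrite iterS nE expgSr conjgM sec_conj_proj //; split=> //; apply: gN.
Qed.

Lemma sec_proj_conj_word m b u : N b ->
  N (conj_word (g ^+ m)%g b u) /\ sec_proj (conj_word (g ^+ m)%g b u) =
    \sum_(j < size u) iter (m * j.+1) sec_conj (sec_proj b) *~ (nth false u j)%:Z.
Proof.
move=> Nb; elim: u => [|c u [Nu uE]] /=.
  by rewrite big_ord0; split=> //; apply: (sub1g sN).
have Nc : N (if c then b else 1%g) by case: c => //; apply: (sub1g sN).
have [Ncu cuE] := sec_conj_iter m (subMg sN Nc Nu); split=> //.
have itD k a a' : iter k sec_conj (a + a') = iter k sec_conj a + iter k sec_conj a'.
  by apply: iter_additive_mapD; apply: sec_conjD.
have it0 k : iter k sec_conj 0 = 0.
  by apply: (addrI (iter k sec_conj 0)); rewrite -itD !addr0.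
rewrite -cuE sec_projD // itD big_ord_recl /= muln1; congr (_ + _).
  by case: (c); rewrite ?mulr1z // mulr0z sec_proj1 it0.
rewrite uE; elim/big_rec2: _ => [|j y1 y2 _ yE]; first exact: it0.
rewrite itD yE; congr (_ + _); case: nth; last by rewrite !mulr0z it0.
by rewrite !mulr1z -iterD -mulnS.
Qed.

(** Two words [u] and [v] of the same length with [b * conj_word t b u] equal to
    [conj_word t b v], for [t = g ^+ m], give the polynomial with constant
    coefficient 1 whose next coefficients are the differences of the letters of
    [u] and [v]. *)
Lemma sec_small_relation m a : no_free_semigroup G -> exists f : {poly int},
  [/\ f != 0, forall i, `|f`_i| <= 1 &
      \sum_(i < size f) iter (m * i) sec_conj a *~ f`_i = 0].
Proof.
move=> nfs; have Na := sec_repr_num a.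
have [u [v [suv E]]] := conj_word_relation (g ^+ m)%g (sec_repr a) nfs.
have [Nu uE] := sec_proj_conj_word m u Na.
have [Nv vE] := sec_proj_conj_word m v Na.
pose e i : int := if i is j.+1 then (nth false u j)%:Z - (nth false v j)%:Z else 1.
pose f := \poly_(i < (size u).+1) e i.
exists f; split.
- apply/eqP => /(congr1 (fun p : {poly int} => p`_0)).
  by rewrite coef_poly coef0.
- move=> i; rewrite coef_poly; case: ifP => // _; case: i => //= j.
  by case: nth; case: nth.
have fs : (size f <= (size u).+1)%N by apply: size_poly.
rewrite (big_ord_widen _ (fun i => iter (m * i) sec_conj a *~ f`_i) fs) big_mkcond.
transitivity (\sum_(i < (size u).+1) iter (m * i) sec_conj a *~ e i).
  apply: eq_bigr => i _; case: ltnP => fi.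
    by rewrite coef_poly ltn_ord.
  suff -> : e i = f`_i by rewrite nth_default.
  by rewrite coef_poly ltn_ord.
have := congr1 sec_proj E; rewrite sec_projD // uE vE sec_reprK -suv => {}E.
rewrite big_ord_recl muln0 mulr1z /=.
transitivity (a + (\sum_(j < size u) iter (m * j.+1) sec_conj a *~ (nth false u j)%:Z
  - \sum_(j < size u) iter (m * j.+1) sec_conj a *~ (nth false v j)%:Z)).
  by congr (_ + _); rewrite -sumrB; apply: eq_bigr => i _; rewrite mulrzBr.
by rewrite addrA E subrr.
Qed.

End SectionConjugation.
End SectionQuotient.

(** * Polynomial growth of solvable groups without free semigroups *)
Section SolvableGrowth.
Variable G : groupType.
Hypothesis nfs : no_free_semigroup G.
Implicit Types (H K M N : set G) (x y g h c : G) (C : seq G).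

(** Let [M] and [N] be generated by [C] and [C'].  By [orbit_short], modulo [M]
    the conjugate of [c] by [g ^+ n] is a word [w n] of polynomial length in
    fixed elements of [N].  The error [m n] in [M] satisfies
    [m n.+1 = v n * m n ^ g], where [v n] is short in [N], lies in [M], and is
    therefore short in [M]; so [m] is short by [poly_short_recurrence]. *)
Lemma poly_conj_abelian C C' g :
  abelian_mod (generated [set` C]) (generated [set` C']) ->
  [set` C] `<=` generated [set` C'] ->
  (forall x, generated [set` C'] x -> generated [set` C'] (x ^ g)) ->
  poly_conj C g -> poly_distorted C C' -> poly_conj C' g.
Proof.
move=> abCC' CC' gN gC [D0 D0P].
have sM := @subgroup_generated _ [set` C]; have sN := @subgroup_generated _ [set` C'].
have CsC' : generated [set` C] `<=` generated [set` C'] by apply: generated_sub.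
pose S := AbelianSection sN sM CsC' abCC'.
have gM x : generated [set` C] x -> generated [set` C] (x ^ g).
  move: x; apply: (@generated_sub _ _ [set x | generated [set` C] (x ^ g)]).
    split=> [|x y /= Mx My]; first by rewrite /= conj1g; apply: (sub1g sM).
    by rewrite conjMg conjVg; apply: (proj2 sM).
  by move=> c /gC[D /(_ 1%N)]; rewrite expg1 => /ball_generated.
move=> c cC'; have Nc : generated [set` C'] c by apply: sub_generated.
have [Y [E YE]] := orbit_short (phi := @sec_conj _ S g)
  (sec_conjD (S := S) gN gM) (sec_proj_gen (S := S) erefl)
  (fun m a _ => sec_small_relation (S := S) gN gM m a nfs) (sec_proj S c).
pose r n := s2val (cid2 (YE n)).
have rE n : iter n (@sec_conj _ S g) (sec_proj S c) =
  (\sum_(k < size Y) Y`_k *~ r n k)%R by rewrite /r; case: cid2.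
have rle n k : (`|r n k| <= n.+2 ^ E)%N by rewrite /r; case: cid2.
pose y k := sec_repr (Y`_k)%R.
have Ny k : generated [set` C'] (y k) by apply: (sec_repr_num (S := S)).
pose w n := \prod_(k < size Y) expz (y k) (r n k).
have wC' : poly_short C' w by apply: poly_short_prod rle.
have wgC' : poly_short C' (fun n => w n ^ g).
  rewrite (_ : (fun n => _) = fun n => \prod_(k < size Y) expz (y k ^ g) (r n k)).
    by apply: (poly_short_prod (y := fun k => y k ^ g) _ _ rle) => k; apply: gN.
  apply/funext => n; rewrite conjg_prod; apply: eq_bigr => k _.
  by case: (r n k) => j; rewrite /= ?conjVg conjXg.
have wP n : generated [set` C'] (w n) /\ sec_proj S (w n) = sec_proj S (c ^ (g ^+ n)).
  have [Nw wE] := sec_proj_prod (S := S) (size Y) (r n) Ny; split=> //.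
  have [_ <-] := sec_conj_iter (S := S) gN gM n Nc.
  by rewrite wE rE; apply: eq_bigr => k _; rewrite /y sec_reprK.
have Ncn n : generated [set` C'] (c ^ (g ^+ n)).
  by have [] := sec_conj_iter (S := S) gN gM n Nc.
pose v n := (w n.+1)^-1 * w n ^ g.
have vM n : generated [set` C] (v n).
  have [Nw1 w1E] := wP n.+1; have [Nw wE] := wP n.
  apply/(sec_proj_eq (S := S)) => //; first exact: gN.
  rewrite w1E expgSr conjgM -(sec_conj_proj (S := S) gN gM (Ncn n)).
  by rewrite -(sec_conj_proj (S := S) gN gM Nw) wE.
have vC : poly_short C v.
  have [D vD] : poly_short C' v.
    apply: poly_shortM => //; apply: poly_shortV; have [D wD] := wC'.
    exists (D * 2)%N => n; apply: ball_le (wD n.+1).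
    rewrite mulnC expnM leq_expl //; nia.
  exists ((D + 1).+1 * D0)%N => n; apply: ball_le (D0P _ _ (vD n) (vM n)).
  by rewrite expnM leq_expl // leq_comp.
pose m n := (w n)^-1 * c ^ (g ^+ n).
have mC : poly_short C m.
  apply: (poly_short_recurrence gC vC) => [|n].
    have [Nw wE] := wP 0%N; have := Ncn 0%N.
    by move=> Ncg; apply/(sec_proj_eq (S := S)).
  by rewrite /m /v (conjMg (w n)^-1) conjVg -(mulgA (w n.+1)^-1) mulVKg expgSr conjgM.
rewrite (_ : (fun n => _) = fun n => w n * m n).
  by apply: poly_shortM => //; apply: poly_short_trans mC.
by apply/funext => n; rewrite /m mulVKg.
Qed.

(** Induction on the derived length of [H]: for the derived subgroup, the
    conjugations by all elements of [K] are under control, those by elements of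
    [H] give the distortion of the derived subgroup in [H] and the growth of
    [H], and the distortion gives the control of conjugations on [H]. *)
Lemma derived_series_poly_growth n H K : fin_gen H -> normal_in H K -> H `<=` K ->
  subgroup K -> iter n (@derived G) H `<=` [set 1] -> exists C,
  [/\ generated [set` C] = H, forall g, K g -> poly_conj C g & poly_growth C].
Proof.
move=> fgH nH HK sK; elim: n H fgH nH HK => [|n IHn] H fgH nH HK Hn.
  exists [::]; split=> //.
    apply/seteqP; split.
      by apply: (generated_sub (fin_gen_subgroup fgH)) => x; rewrite /= in_nil.
    by move=> x /Hn ->; apply: (sub1g (@subgroup_generated _ _)).
  exists 0%N => k; exists [:: 1] => // x xk; rewrite inE; apply/eqP.
  by have := ball_generated xk; apply: (generated_sub (@subgroup1 G)) => y; rewrite /= in_nil.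
have sH := fin_gen_subgroup fgH; have DH := derived_id sH.
have sD : subgroup (derived H) by apply: subgroup_generated.
have fgD : fin_gen (derived H).
  by apply: fin_gen_abelian_kernel fgH sD DH _ => //; apply: derived_abelian.
have [C [CE sC gC]] := IHn _ fgD (derived_normal nH) (subset_trans DH HK)
  (ltac:(by rewrite iterSr in Hn)).
have [l lE] := fgH; have lH x : x \in l -> H x by rewrite -lE; apply: sub_generated.
have [dl gl] : poly_distorted C (l ++ C) /\ (poly_growth C -> poly_growth (l ++ C)).
  apply: abelian_poly_step => [x y /lH Hx /lH Hy|x /lH /HK Kx].
    by rewrite CE; apply: derived_abelian.
  by split; apply: sC => //; apply: (subVg sK).
have lCE : generated [set` l ++ C] = H.
  apply/seteqP; split.
    apply: generated_sub => // x; rewrite /= mem_cat => /orP[/lH//|xC].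
    by apply: DH; rewrite -CE; apply: sub_generated.
  by rewrite -lE; apply: generated_mono => x xl; rewrite /= mem_cat xl.
exists (l ++ C); split=> // [g Kg|]; last exact: gl.
apply: poly_conj_abelian dl => //; rewrite ?lCE ?CE.
- exact: derived_abelian.
- by move=> x xC; apply: DH; rewrite -CE; apply: sub_generated.
- by move=> x Hx; apply: nH.
- exact: sC.
Qed.

(** By Schreier rewriting, balls in the whole group are covered by finitely
    many translates of balls in the subgroup of finite index. *)
Lemma virtually_solvable_poly_growth C : generated [set` C] = [set: G] ->
  virtually_solvable [set: G] -> poly_growth C.
Proof.
move=> CE [K [sK KG nK fK [n Kn]]]; rewrite -CE in KG fK.
have [s [C' [C'K C's]]] := schreier sK KG fK.
have fgK : fin_gen K by exists C'.
have nKK : normal_in K K by move=> x g; apply: subJg.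
have [C1 [C1K _ [D C1D]]] := derived_series_poly_growth fgK nKK (@subset_refl _ K) sK Kn.
have [k kC] : exists k, forall c, c \in C' -> ball C1 k c.
  by apply: ball_uniform; rewrite C1K -C'K; apply: sub_generated.
exists ((1 + k + 1).+1 * D + size s)%N => m.
have [t ts tP] := C1D (m * k)%N; exists [seq x * r | x <- t, r <- s].
  rewrite size_allpairs leq_expM ?leq_exp2S //; apply: (leq_trans ts).
  rewrite expnM leq_expl //; apply: leq_trans (leq_comp m (1 + k)).
  by rewrite !ltnS leq_expM ?leq_exp2S // expn1; lia.
move=> x /C's[r rs /(ball_trans kC) /tP xt]; apply/allpairsP.
by exists (x * r^-1, r); rewrite mulgVK.
Qed.

End SolvableGrowth.

(** * Distances, balls and fires in graphs *)
Section GraphDistance.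
Variable G : connected_graph.
Implicit Types (x y z : G) (X : {fset G}) (W : nat -> {fset G}).

Lemma graph_distP x y :
  exists p : seq G, [/\ path adj x p, last x p = y & size p = graph_dist x y].
Proof. by rewrite /graph_dist; case: ex_minnP => n /asboolP. Qed.

Lemma graph_dist_le x p : path adj x p -> graph_dist x (last x p) <= size p.
Proof.
move=> xp; rewrite /graph_dist; case: ex_minnP => n _; apply.
by apply/asboolP; exists p.
Qed.

Lemma graph_dist0 x : graph_dist x x = 0.
Proof. by apply/eqP; rewrite -leqn0; apply: (@graph_dist_le x [::]). Qed.

Lemma graph_dist_triangle x y z :
  graph_dist x z <= graph_dist x y + graph_dist y z.
Proof.
have [p [xp <- <-]] := graph_distP x y.
have [q [yq <- <-]] := graph_distP (last x p) z.
by rewrite -size_cat -last_cat; apply: graph_dist_le; rewrite cat_path xp.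
Qed.

Lemma graph_dist_sym x y : graph_dist x y = graph_dist y x.
Proof.
suff le (a b : G) : graph_dist b a <= graph_dist a b.
  by apply/eqP; rewrite eqn_leq !le.
have [p [ap <- <-]] := graph_distP a b.
have := @graph_dist_le (last a p) (rev (belast a p)).
rewrite rev_path size_rev size_belast.
have -> : last (last a p) (rev (belast a p)) = a.
  by case: p {ap} => //= c p; rewrite rev_cons last_rcons.
by apply; rewrite (eq_path (e' := adj)) // => u v; rewrite adj_sym.
Qed.

Lemma finite_graph_ball x n : finite_set (graph_ball x n).
Proof.
elim: n => [|n IHn].
  apply: (@sub_finite_set _ _ [set x]); last exact: finite_set1.
  move=> y; rewrite /graph_ball /= leqn0 => /eqP d0.
  have [p [_ yE]] := graph_distP x y; rewrite d0 => /size0nil p0.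
  by rewrite -yE p0.
apply: (@sub_finite_set _ _ (graph_ball x n `|`
  \bigcup_(y in graph_ball x n) [set z | adj y z])); last first.
  rewrite finite_setU; split=> //; apply: bigcup_finite => // y _.
  exact: adj_locally_finite.
move=> z; rewrite /graph_ball /= leq_eqVlt => /orP[/eqP dz|]; last by left.
right; have [p [xp pz ps]] := graph_distP x z.
case/lastP: p xp pz ps => [|p y]; first by rewrite /= dz.
rewrite rcons_path last_rcons size_rcons dz => /andP[xp py] yz [ps].
exists (last x p) => /=; last by rewrite -yz.
by rewrite /graph_ball /= -ps; apply: graph_dist_le.
Qed.

Lemma finset_sub_ball x X : exists r, [set` X] `<=` graph_ball x r.
Proof.
exists (\max_(y <- X) graph_dist x y) => y yX.
by rewrite /graph_ball /=; apply: leq_bigmax_seq.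
Qed.

Lemma burning_ball X W x r n : [set` X] `<=` graph_ball x r ->
  burning X W n `<=` graph_ball x (r + n).
Proof.
move=> Xr; elim: n => [|n IHn]; first by rewrite addn0.
move=> v /= [[u /IHn ur vu] _]; rewrite /graph_ball /= in ur *.
apply: leq_trans (graph_dist_triangle x u v) _.
by rewrite addnS -addn1 leq_add // graph_dist_sym.
Qed.

Lemma burning_incr X W n :
  (forall n, burning X W n `&` [set` W n.+1] = set0) ->
  burning X W n `<=` burning X W n.+1.
Proof.
move=> XW v Xv /=; split; first by exists v; rewrite ?graph_dist0.
have vn : v \notin W n.+1.
  by apply/negP => vW; have : (burning X W n `&` [set` W n.+1]) v by []; rewrite XW.
move=> k /andP[k1]; rewrite leq_eqVlt => /orP[/eqP->//|kn].
by case: n Xv kn {vn} => [|n] /= Xv kn; [lia|apply: (proj2 Xv); rewrite k1].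
Qed.

End GraphDistance.

Section GrowthContainment.
Variables (R : realType) (G : connected_graph).
Local Open Scope ring_scope.

(** The cardinals are bounded, and the sequence is constant from the point
    where the largest one is attained. *)
Lemma incr_stabilizes (T : choiceType) (X : nat -> set T) (B : set T) :
  finite_set B -> (forall n, X n `<=` B) -> (forall n, X n `<=` X n.+1) ->
  exists2 N, (0 < N)%N & forall n, (N <= n)%N -> X n = X N.
Proof.
move=> fB XB Xincr; have fX n : finite_set (X n) by apply: sub_finite_set fB.
have Xmono m n : (m <= n)%N -> X m `<=` X n.
  by move=> /subnK <-; elim: (n - m)%N => // k IHk; apply: subset_trans IHk _.
pose f n := #|` fset_set (X n)|.
have fle m n : (m <= n)%N -> (f m <= f n)%N.
  by move=> mn; apply/fsubset_leq_card; rewrite -fset_set_sub //; apply: Xmono.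
have fB' n : (f n <= #|` fset_set B|)%N.
  by apply/fsubset_leq_card; rewrite -fset_set_sub.
have ex : exists k, `[< exists n, f n = k >] by exists (f 0%N); apply/asboolP; exists 0%N.
have bd k : `[< exists n, f n = k >] -> (k <= #|` fset_set B|)%N.
  by move=> /asboolP[n <-].
case: (ex_maxnP ex bd) => k /asboolP[N fN] kmax; exists N.+1 => // n Nn.
have fn : (f n <= f N.+1)%N.
  apply: (@leq_trans (f N)); last exact: fle.
  by rewrite fN; apply: kmax; apply/asboolP; exists n.
have E : fset_set (X N.+1) = fset_set (X n).
  apply/eqP; rewrite eqEfcard fn andbT -fset_set_sub //; exact: Xmono.
by rewrite -[LHS]fset_setK // -E fset_setK.
Qed.

Lemma polynomial_growth_containment (g0 : G) d :
  polynomial_growth_degree R g0 d -> polynomial_containment_degree R G d.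
Proof.
move=> [C C0 gC]; exists (C * 2 ^+ d); first by rewrite mulr_gt0 ?exprn_gt0.
move=> X0; have [r0 X0r0] := finset_sub_ball g0 X0; pose r := r0.+1.
have X0r : [set` X0] `<=` graph_ball g0 r.
  by move=> x /X0r0; rewrite /graph_ball /= => /leqW.
(* Nothing is protected before time [r], when the whole sphere of radius
   [2 r] is. *)
pose wall := fset_set [set v : G | graph_dist g0 v = (r + r)%N].
have fwall : finite_set [set v : G | graph_dist g0 v = (r + r)%N].
  apply: sub_finite_set (finite_graph_ball g0 (r + r)) => v.
  by rewrite /graph_ball /= => ->.
have inwall v : (v \in wall) = (graph_dist g0 v == (r + r)%N).
  rewrite /wall in_fset_set //; apply/idP/eqP; first by rewrite inE.
  by move=> vr; rewrite inE.
pose W n : {fset G} := if n == r then wall else fset0.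
have Wn n v : (v \in W n) = (n == r) && (graph_dist g0 v == (r + r)%N).
  by rewrite /W; case: eqP => //= _; rewrite inE.
have Xr n : burning X0 W n `<=` graph_ball g0 (r + minn n r0).
  elim: n => [|n IHn]; first by rewrite min0n addn0.
  move=> v /= [[u /IHn ur vu] vW]; rewrite /graph_ball /= in ur *.
  have vr : (graph_dist g0 v <= (r + minn n r0).+1)%N.
    apply: leq_trans (graph_dist_triangle g0 u v) _.
    by rewrite -addn1 leq_add // graph_dist_sym.
  case: (ltnP n r0) => nr; first by move: vr; rewrite /r; lia.
  have := vW r; rewrite Wn eqxx /= => /(_ ltac:(by rewrite /r; lia)) /eqP.
  by move: vr; rewrite /r; lia.
have XW n : burning X0 W n `&` [set` W n.+1] = set0.
  rewrite -subset0 => v [/Xr]; rewrite /graph_ball /= Wn => vr /andP[/eqP nr /eqP].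
  by move: vr nr; rewrite /r; lia.
exists W; split=> //.
- move=> n n1; rewrite /W; case: eqP => [->|_]; last first.
    by rewrite cardfs0 !mulr_ge0 ?exprn_ge0 ?(ltW C0).
  apply: (@le_trans _ _ (#|` fset_set (graph_ball g0 (r + r))|%:R)).
    rewrite ler_nat; apply/fsubset_leq_card; rewrite -fset_set_sub //.
      by move=> v; rewrite /graph_ball /= => ->.
    exact: finite_graph_ball.
  apply: le_trans (gC (r + r)%N _) _; first by rewrite /r; lia.
  by rewrite -mulrA -exprMn -natrM mul2n addnn lexx.
apply: (incr_stabilizes (X := burning X0 W) (finite_graph_ball g0 (r + r))) => n.
  by apply: subset_trans (Xr n) _ => v; rewrite /graph_ball /= /r; lia.
exact: burning_incr.
Qed.

End GrowthContainment.

Local Open Scope fset_scope.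

(** * Fires in groups with expanding sets *)

(** [(1 + x) ^ D <= 1 + 3 ^ D * x] for [x] between 0 and 1, applied to the
    inverse of [n + N]. *)
Lemma polynomial_ratio (R : realType) (D : nat) (e : R) : (0 < e)%R ->
  exists2 N : nat, (0 < N)%N &
    forall n, ((n.+1 + N)%:R ^+ D <= (1 + e) * (n + N)%:R ^+ D)%R.
Proof.
move=> e0; have onex (x : R) : (0 <= x <= 1 -> (1 + x) ^+ D <= 1 + 3 ^+ D * x)%R.
  move=> /andP[x0 x1]; elim: D => [|k IHk]; first by rewrite !expr0 mul1r lerDl.
  have k3 : (1 <= 3 ^+ k :> R)%R by rewrite exprn_ege1 // ler1n.
  rewrite !exprS; apply: le_trans (ler_wpM2l _ IHk) _; first by lra.
  move: k3; move: (3 ^+ k)%R => y y1.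
  have yx : (0 <= (y - 1) * x)%R by rewrite mulr_ge0 // subr_ge0.
  have yxx : (0 <= y * x * (1 - x))%R by rewrite !mulr_ge0 ?subr_ge0 //; lra.
  by lra.
pose N := (Num.bound (3 ^+ D / e)%R).+1; exists N => // n.
have m0 : (0 < (n + N)%:R :> R)%R by rewrite ltr0n addnS.
have Ne : (3 ^+ D <= e * (n + N)%:R)%R.
  rewrite mulrC -ler_pdivrMr // ltW //.
  apply: lt_le_trans (archi_boundP _) _.
    by rewrite divr_ge0 ?exprn_ge0 // ltW.
  by rewrite ler_nat /N addnS; apply: leqW; apply: leq_addl.
have -> : ((n.+1 + N)%:R = (n + N)%:R * (1 + (n + N)%:R^-1) :> R)%R.
  by rewrite mulrDr mulr1 mulfV ?gt_eqF // addSn -addn1 natrD.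
rewrite exprMn mulrC ler_pM2r ?exprn_gt0 //.
apply: le_trans (onex _ _) _.
  by rewrite invr_ge0 ltW //= invf_le1 // ler1n addnS.
by rewrite lerD2l ler_pdivrMr.
Qed.

Section Fire.
Variables (R : realType) (G : groupType) (S : {fset G}) (genS : generates S).
Local Notation Gamma := (cayley_graph genS).
Implicit Types (x y z c p q t : G) (K T : {fset G}) (W : nat -> {fset G}).

Lemma generates_generated : generated [set` S] = [set: G].
Proof.
have sg := @subgroup_generated _ [set` S]; apply/seteqP; split=> // x _; apply/asboolP.
apply: (genS (H := [pred x | `[< generated [set` S] x >]])).
  split; first by apply/asboolP; apply: (sub1g sg).
  by move=> y z /asboolP gy /asboolP gz; apply/asboolP; apply: (proj2 sg).
by move=> s sS; apply/asboolP; apply: sub_generated.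
Qed.

Lemma letter_dist x c : c \in letters S -> (@graph_dist Gamma x (x * c)%g <= 1)%N.
Proof.
move=> cS; have [->|c1] := eqVneq c 1; first by rewrite mulg1 graph_dist0.
apply: (@graph_dist_le Gamma x [:: x * c]); rewrite /= andbT /cayley_adj.
have -> : x != x * c.
  by apply: contraNneq c1 => xE; rewrite -(mulKg x c) -xE mulVg.
rewrite mulKg invgM mulgVK /=.
move: cS; rewrite !inE (negPf c1) /= mem_cat => /orP[->//|/mapP[d dS ->]].
by rewrite invgK dS orbT.
Qed.

Lemma burning_spread X0 W n z l :
  burning (G := Gamma) X0 W n z ->
  (forall p j, ball S l p -> (1 <= j <= n + l)%N -> z * p \notin W j) ->
  forall k, (k <= l)%N -> forall p, ball S k p ->
    burning (G := Gamma) X0 W (n + k)%N (z * p).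
Proof.
move=> nz zW; elim=> [|k IHk] kl p; first by move=> ->; rewrite addn0 mulg1.
move=> [q qk [c cS ->]]; rewrite addnS /=; split.
  exists (z * q); first by apply: IHk => //; apply: ltnW.
  by rewrite mulgA (@graph_dist_sym Gamma); apply: letter_dist.
move=> j /andP[j1 jn]; apply: zW; last by lia.
by apply: (@ball_le _ _ k.+1) => //; exists q => //; exists c.
Qed.

Definition setmul K T : {fset G} := [fset z * t | z in K, t in T].

Lemma mem_setmul K T z t : z \in K -> t \in T -> z * t \in setmul K T.
Proof. by move=> zK tT; apply/imfset2P; exists z => //; exists t. Qed.

Lemma setmulP K T y : y \in setmul K T ->
  exists z t, [/\ z \in K, t \in T & y = z * t].
Proof. by move=> /imfset2P[z zK [t tT ->]]; exists z, t. Qed.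

Section Escape.
Variables (T : {fset G}) (e : R) (Q : {fset G} -> Prop) (K0 : {fset G}).
Hypotheses (e0 : (0 < e)%R) (QK0 : Q K0) (K00 : K0 != fset0).
Hypothesis Qsub : forall K K', K' `<=` K -> Q K -> Q K'.
Hypothesis Qmul : forall K, Q K -> Q (setmul K T).
Hypothesis Qgrow : forall K, Q K ->
  ((1 + e) * #|` K|%:R <= #|` setmul K T|%:R :> R)%R.

(** A nonempty set of the family, multiplied repeatedly by [T]. *)
Lemma arbitrarily_large M : exists2 K, Q K & (M <= #|` K|%:R :> R)%R.
Proof.
have large n : exists2 K, Q K & (1 + e * n%:R <= #|` K|%:R :> R)%R.
  elim: n => [|n [K QK Kn]].
    by exists K0 => //; rewrite mulr0 addr0 ler1n cardfs_gt0.
  exists (setmul K T); first exact: Qmul.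
  apply: le_trans (Qgrow QK); rewrite -addn1 natrD.
  have n0 : (0 <= n%:R :> R)%R by [].
  move: Kn n0; move: (#|` K|%:R)%R (n%:R)%R => a b ab b0.
  have eb : (0 <= e * b)%R by rewrite mulr_ge0 // ltW.
  have ea : (e * 1 <= e * a)%R by rewrite ler_pM2l //; lra.
  by lra.
have [K QK Kn] := large (Num.bound (`|M| / e)%R); exists K => //.
apply: le_trans Kn; have M0 : (0 <= `|M| / e)%R by rewrite divr_ge0 // ltW.
have := archi_boundP M0; rewrite ltr_pdivrMr // => /ltW Me.
apply: (le_trans (ler_norm M)); apply: le_trans Me _.
by rewrite mulrC lerDr ler01.
Qed.

(** Multiplication by [T] takes [l] time steps.  Up to time [l * n.+1], at most
    [C * (l * n.+1) ^ D] vertices with [D = d + 1] have been protected, and each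
    of them lies on a path from [z] to [z * t] for at most [size P] points [z].
    After removal of these points, the remaining part of the fire spreads
    unhindered.  The lower bound [M * (n + N) ^ D] for the size of the fire at
    time [l * n] propagates: [N] is chosen so that the step from [n] to [n + 1]
    costs at most a factor [1 + e / 2], and [M] so that the rest of the factor
    [1 + e] pays for the protected vertices. *)
Lemma fire_escapes d : ~ polynomial_containment_degree R Gamma d.
Proof.
move=> [C C0 cont].
have [l0 Tl0] : exists l, forall t, t \in enum_fset T -> ball S l t.
  by apply: ball_uniform => t _; rewrite generates_generated.
pose l := l0.+1; have Tl t : t \in T -> ball S l t.
  by move=> /Tl0; apply: ball_le.
have [P PP] := finite_ball S l; pose D := d.+1.
pose beta : R := ((size P)%:R * C * l%:R ^+ D)%R.
have beta0 : (0 <= beta)%R by rewrite !mulr_ge0 ?exprn_ge0 // ltW.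
have [N N0 ND] : exists2 N : nat, (0 < N)%N &
    forall n, ((n.+1 + N)%:R ^+ D <= (1 + e / 2) * (n + N)%:R ^+ D :> R)%R.
  by apply: polynomial_ratio; rewrite divr_gt0.
pose M : R := (1 + 2 * (1 + e) * beta / e)%R.
have M1 : (1 <= M)%R.
  by rewrite lerDl !mulr_ge0 ?invr_ge0 ?addr_ge0 ?exprn_ge0 ?ler01 ?(ltW e0) ?(ltW C0).
have Mbeta : (M * (1 + e / 2) <= (1 + e) * (M - beta))%R.
  have : (e * M = e + 2 * (1 + e) * beta)%R.
    by rewrite /M mulrDr mulr1 [(e * _)%R]mulrC divfK // gt_eqF.
  move=> ME; rewrite -subr_ge0.
  have -> : ((1 + e) * (M - beta) - M * (1 + e / 2) = e * M / 2 - (1 + e) * beta)%R.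
    by clearbody M beta; field.
  rewrite ME (_ : _ - _ = e / 2)%R; first by rewrite divr_ge0 // ltW.
  by clearbody M beta; field.
have [X0 QX0 X0M] := arbitrarily_large (M * N%:R ^+ D)%R.
have [W [Wsize XW [T0 T00 stab]]] := cont X0.
pose walls m := flatten [seq enum_fset (W j) | j <- iota 1 m].
have walls_size m : ((size (walls m))%:R <= C * m%:R ^+ D :> R)%R.
  suff wk k : (k <= m)%N -> ((size (walls k))%:R <= k%:R * (C * m%:R ^+ d) :> R)%R.
    by apply: le_trans (wk m (leqnn m)) _; rewrite exprS mulrCA.
  elim: k => [|k IHk] km; first by rewrite mul0r.
  have -> : walls k.+1 = walls k ++ W k.+1.
    by rewrite /walls -[X in iota 1 X]addn1 iotaD map_cat flatten_cat /= cats0 add1n.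
  rewrite size_cat natrD -[X in (X%:R * _)%R]addn1 natrD mulrDl mul1r lerD //.
    by apply: IHk; apply: ltnW.
  apply: le_trans (Wsize k.+1 isT) _.
  by rewrite ler_pM2l // lerXn2r ?nnegrE // ler_nat.
have claim n : exists K, [/\ Q K,
    forall z, z \in K -> burning (G := Gamma) X0 W (l * n)%N z &
    (M * (n + N)%:R ^+ D <= #|` K|%:R :> R)%R].
  elim: n => [|n [K [QK Kburn Ksize]]].
    by exists X0; split=> // z zX; rewrite muln0.
  pose blocked := [seq w * q^-1 | w <- walls (l * n.+1)%N, q <- P].
  pose K' := [fset z in K | z \notin blocked].
  have K'K : K' `<=` K by apply/fsubsetP => z; rewrite !inE => /andP[].
  have QK' := Qsub K'K QK; exists (setmul K' T); split; first exact: Qmul.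
    move=> _ /setmulP[z [t [zK' /Tl tl ->]]]; rewrite mulnS addnC.
    apply: (@burning_spread X0 W (l * n)%N z l) => //.
      by apply: Kburn; apply: (fsubsetP K'K).
    move=> p j pl /andP[j1 jl]; apply/negP => zp.
    move: zK'; rewrite !inE => /andP[_ /negP]; apply.
    apply/allpairsP; exists (z * p, p); rewrite /= mulgK; split=> //; last exact: PP.
    apply/flatten_mapP; exists j => //; rewrite mem_iota.
    by rewrite mulnS; lia.
  apply: le_trans (Qgrow QK').
  have cardK : (#|` K| <= #|` K'| + size blocked)%N.
    apply: (@leq_trans #|` K' `|` [fset x in blocked]|).
      apply/fsubset_leq_card/fsubsetP => z zK; rewrite !inE zK /=.
      by case: (z \in blocked).
    apply: leq_trans (leq_card_fsetU _ _) _; rewrite leq_add2l.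
    by rewrite card_fseq size_undup.
  have bsize : ((size blocked)%:R <= beta * (n + N)%:R ^+ D :> R)%R.
    rewrite size_allpairs mulnC natrM /beta -!mulrA ler_wpM2l //.
    apply: le_trans (walls_size _) _; rewrite ler_pM2l // natrM exprMn.
    rewrite ler_wpM2l ?exprn_ge0 // lerXn2r ?nnegrE // ler_nat.
    by move: N0; lia.
  move: cardK; rewrite -(ler_nat R) natrD => cardK.
  have := ND n; move: cardK bsize Ksize Mbeta M1.
  have y0 : (0 <= (n + N)%:R ^+ D :> R)%R by rewrite exprn_ge0.
  move: (#|` K|%:R)%R (#|` K'|%:R)%R ((size blocked)%:R)%R y0.
  move: ((n + N)%:R ^+ D)%R ((n.+1 + N)%:R ^+ D)%R => y y' a a' b y0 ab bs Ka Mb M1' yy.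
  have h1 : (M * y' <= M * ((1 + e / 2) * y))%R by rewrite ler_wpM2l //; lra.
  have h2 : (M * (1 + e / 2) * y <= (1 + e) * (M - beta) * y)%R by rewrite ler_wpM2r.
  have h3 : ((1 + e) * ((M - beta) * y) <= (1 + e) * a')%R.
    rewrite ler_wpM2l ?addr_ge0 ?ler01 ?(ltW e0) //.
    by rewrite mulrBl lerBlDr (le_trans Ka) // (le_trans ab) // lerD2l.
  by rewrite (le_trans h1) // mulrA (le_trans h2) // -mulrA.
have [B BP] : exists B : {fset G}, forall z,
    burning (G := Gamma) X0 W T0 z -> z \in B.
  have [r X0r] := @finset_sub_ball Gamma 1 X0.
  have fb := finite_graph_ball (G := Gamma) 1 (r + T0).
  exists (fset_set (@graph_ball Gamma 1 (r + T0))) => z /(burning_ball X0r) zb.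
  by rewrite in_fset_set // inE.
pose n := (T0 + #|` B|)%N; have [K [_ Kb Kn]] := claim n.
have KB : K `<=` B.
  apply/fsubsetP => z /Kb; rewrite stab; first exact: BP.
  by rewrite /n /l; nia.
have := le_trans Kn (_ : #|` K|%:R <= #|` B|%:R :> R)%R.
rewrite ler_nat => /(_ (fsubset_leq_card KB)); apply/negP; rewrite -ltNge.
apply: (@lt_le_trans _ _ ((n + N)%:R ^+ D)%R); last first.
  by rewrite ler_peMl // exprn_ge0.
apply: (@lt_le_trans _ _ (n + N)%:R%R); first by rewrite ltr_nat /n; lia.
by rewrite exprS ler_peMr // exprn_ege1 // ler1n; lia.
Qed.
End Escape.
End Fire.

(** * Groups with polynomial containment *)
Section Consequences.
Variables (R : realType) (G : groupType) (S : {fset G}) (genS : generates S).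

(** Multiplication by two free generators doubles the sets of words of a given
    length; words of different lengths may coincide, hence the family [Q]. *)
Lemma containment_no_free_semigroup d :
  polynomial_containment_degree R (cayley_graph genS) d -> no_free_semigroup G.
Proof.
move=> cont x y; apply: contrapT => free.
have inj u v : size u = size v -> word_eval x y u = word_eval x y v -> u = v.
  by move=> suv uv; apply: contrapT => nuv; apply: free; exists u, v.
pose Q (K : {fset G}) := exists m, forall z, z \in K ->
  exists2 u, size u = m & z = word_eval x y u.
have wr u b : word_eval x y (rcons u b) = word_eval x y u * (if b then x else y).
  elim: u => [|a u IHu] /=; first by rewrite mulg1 mul1g.
  by rewrite IHu mulgA.
have xy : x != y.
  apply/eqP => xy; have := inj [:: true] [:: false] erefl.
  by rewrite /= xy => /(_ erefl).
apply: (@fire_escapes R G S genS [fset x; y] 1%R Q [fset 1] _ _ _ _ _ _ d cont).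
- exact: ltr01.
- by exists 0%N => z; rewrite inE => /eqP->; exists [::].
- by rewrite -cardfs_gt0 cardfs1.
- by move=> K K' /fsubsetP KK' [m Km]; exists m => z /KK'; apply: Km.
- move=> K [m Km]; exists m.+1 => _ /setmulP[z [t [/Km[u um ->] tT ->]]].
  move: tT; rewrite !inE => /orP[]/eqP->.
    by exists (rcons u true); rewrite ?size_rcons ?um // wr.
  by exists (rcons u false); rewrite ?size_rcons ?um // wr.
move=> K [m Km].
pose f t := [fset z * t | z in K].
have cardf t : #|` f t| = #|` K| by rewrite card_imfset //; apply: mulIg.
have disj : [disjoint f x & f y].
  apply/fdisjointP => _ /imfsetP[z /= zK ->]; apply/negP => /imfsetP[z' /= z'K].
  have [u um ->] := Km z zK; have [u' um' ->] := Km z' z'K.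
  have := wr u true; have := wr u' false => /= <- <- E.
  have := inj (rcons u true) (rcons u' false); rewrite !size_rcons um um'.
  by move=> /(_ erefl E) /rcons_inj[].
have sub : f x `|` f y `<=` setmul K [fset x; y].
  apply/fsubsetP => z; rewrite inE => /orP[] /imfsetP[z' /= z'K ->];
    by apply: mem_setmul; rewrite // !inE eqxx ?orbT.
have := fsubset_leq_card sub; rewrite -(ler_nat R); apply: le_trans.
move: (cardfsUI (f x) (f y)); rewrite (eqP disj) cardfs0 addn0 => ->.
by rewrite !cardf natrD mulrDl mul1r.
Qed.

(** An edge leaving [K] is determined by its endpoint outside [K], which lies
    in [setmul K T], and by a letter.  So a positive Cheeger constant [h] makes
    [setmul K T] larger than [K] by the factor [1 + h / #|` T|]. *)
Lemma containment_amenable d :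
  polynomial_containment_degree R (cayley_graph genS) d -> amenable R G.
Proof.
move=> cont; exists S, genS; rewrite /amenable_graph; set h := cheeger _ _.
apply: contrapT => h0.
pose E := [set (#|` fset_set (edge_boundary (G := cayley_graph genS) K)|%:R / #|` K|%:R : R)%R
      | K in [set K : {fset cayley_graph genS} | K != fset0]].
have E0 r : E r -> (0 <= r)%R by case=> K _ <-; rewrite divr_ge0.
have hE r : E r -> (h <= r)%R.
  by move=> Er; apply: ge_inf => //; exists 0%R => s; apply: E0.
have hge : (0 <= h)%R.
  apply: lb_le_inf; last by move=> r; apply: E0.
  pose K1 : {fset G} := [fset 1].
  exists (#|` fset_set (edge_boundary (G := cayley_graph genS) K1)|%:R / #|` K1|%:R)%R.
  by exists K1 => //=; rewrite -cardfs_gt0 cardfs1.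
have hpos : (0 < h)%R by rewrite lt_def hge andbT; apply/eqP.
pose T : {fset G} := [fset s in letters S].
have inT t : (t \in T) = (t \in letters S) by rewrite /T in_fset.
have T0 : (0 < #|` T|)%N.
  by rewrite cardfs_gt0; apply/fset0Pn; exists 1; rewrite !inE eqxx.
have h' : (0 < h / #|` T|%:R)%R by rewrite divr_gt0 // ltr0n.
apply: (@fire_escapes R G S genS T _ (fun=> True) [fset 1] h' _ _ _ _ _ d cont) => //.
  by rewrite -cardfs_gt0 cardfs1.
move=> K _; have [->|K0] := eqVneq K fset0; first by rewrite cardfs0 mulr0.
have KT : K `<=` setmul K T.
  apply/fsubsetP => z zK; rewrite -[z]mulg1; apply: mem_setmul => //.
  by rewrite !inE eqxx.
have bound : (#|` fset_set (edge_boundary (G := cayley_graph genS) K)| <=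
    #|` setmul K T `\` K| * #|` T|)%N.
  pose s := [seq (y * t, y) | y <- setmul K T `\` K, t <- T].
  pose L : {fset G * G} := [fset e in s].
  apply: (@leq_trans #|` L|).
    apply/fsubset_leq_card/fsubsetP => e.
    have fin : finite_set (edge_boundary (G := cayley_graph genS) K).
      have sub : (edge_boundary (G := cayley_graph genS) K `<=`
          \bigcup_(x in [set` K]) (pair x @` [set y : G | cayley_adj S x y]))%classic.
        by move=> [x y] [/= xK _ xy]; exists x => //; exists y.
      apply: (sub_finite_set sub); apply: bigcup_finite; first exact: finite_fset.
      by move=> x _; apply/finite_image/cayley_adj_locally_finite.
    rewrite in_fset_set // inE; case: e => x y [/= xK yK].
    move=> /andP[_ xy].
    have [t tT xE] : exists2 t, t \in T & x = y * t.
      exists (y^-1 * x); last by rewrite mulVKg.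
      rewrite inT inE mem_cat; apply/orP; right.
      case/orP: xy => xyS; last by rewrite xyS.
      by apply/orP; right; apply/mapP; exists (x^-1 * y); rewrite // invgM invgK.
    rewrite /L in_fset; apply/allpairsP; exists (y, t).
    rewrite /= -xE; split=> //; rewrite inE yK /=.
    apply/imfset2P; exists x => //; exists t^-1; last by rewrite xE mulgK.
    by rewrite inT; apply: letters_inv; rewrite -inT.
  rewrite card_fseq; apply: leq_trans (size_undup s) _.
  by rewrite size_allpairs.
have Epos : (h <= #|` fset_set (edge_boundary (G := cayley_graph genS) K)|%:R / #|` K|%:R)%R.
  by apply: hE; exists K.
have Kpos : (0 < #|` K|%:R :> R)%R by rewrite ltr0n cardfs_gt0.
have card : #|` setmul K T| = (#|` K| + #|` setmul K T `\` K|)%N.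
  by rewrite cardfsD (fsetIidPr KT) addnC subnK // fsubset_leq_card.
rewrite card natrD mulrDl mul1r lerD2l mulrAC ler_pdivrMr ?ltr0n //.
rewrite ler_pdivlMr // in Epos; apply: le_trans Epos _.
by rewrite -natrM ler_nat.
Qed.

End Consequences.

(** * The equivalence *)
Lemma poly_growth_polynomial_growth (R : realType) (G : groupType) (S : {fset G})
    (genS : generates S) :
  poly_growth S -> polynomial_growth R G.
Proof.
move=> [D SD]; exists S, genS, D.
exists (3 ^+ D)%R; first by rewrite exprn_gt0 // ltr0n.
move=> n n1; have [s ss sP] := SD n.
have ball_path (p : seq G) x : path (cayley_adj S) x p -> ball S (size p) (x^-1 * last x p)%g.
  elim/last_ind: p => [|p y IHp]; first by rewrite /= mulVg.
  rewrite rcons_path last_rcons size_rcons => /andP[/IHp xp /andP[_ py]].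
  exists (x^-1 * last x p)%g => //; exists ((last x p)^-1 * y)%g; last first.
    by rewrite mulgA mulgK.
  case/orP: py => [|py]; first exact: mem_letters.
  by rewrite -[(_ * _)%g]invgK; apply/letters_inv/mem_letters; rewrite invgM invgK.
have sub : (fset_set (graph_ball (1%g : cayley_graph genS) n) `<=` [fset x in s])%fset.
  apply/fsubsetP => x; rewrite in_fset_set; last exact: finite_graph_ball.
  rewrite !inE => xn; apply: sP.
  have [p [p1 px ps]] := graph_distP (1%g : cayley_graph genS) x.
  have := ball_path p 1%g p1; rewrite px invg1 mul1g; apply: ball_le.
  by rewrite ps.
apply: (@le_trans _ _ ((3 * n) ^ D)%:R%R); last by rewrite natrX natrM exprMn.
rewrite ler_nat; apply: leq_trans (fsubset_leq_card sub) _.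
rewrite card_fseq; apply: leq_trans (size_undup s) _; apply: leq_trans ss _.
by apply: leq_expl; lia.
Qed.

Theorem mainTheorem3 (R : realType) (Gamma : groupType) :
  finitely_generated Gamma ->
  elementary_amenable Gamma \/ ~ amenable R Gamma ->
  polynomial_growth R Gamma <-> polynomial_containment R Gamma.
Proof.
move=> _ EA; split=> [[S [genS [d gr]]]|[S [genS [d cont]]]].
  by exists S, genS, d; apply: polynomial_growth_containment gr.
case: EA => [EA|na]; last by case: na; apply: containment_amenable cont.
have nfs := containment_no_free_semigroup cont.
have genT := generates_generated genS.
apply: (poly_growth_polynomial_growth R genS).
apply: (virtually_solvable_poly_growth nfs genT).
apply: tower_virtually_solvable; first by rewrite -genT; apply: subgroup_generated.
by apply: elementary_amenable_tower => //; exists S.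
Qed.
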